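(* Let $X,U,Y$ be complex Banach spaces, let $\{e^{tA}\}_{t\ge0}$ be a hyperbolic strongly continuous semigroup on $X$ with generator $A$, and let $B\in\mathcal L(U,X)$, $C\in\mathcal L(X,Y)$. Then $$rc_{dich}(\{e^{tA}\},B,C)=\inf_{\xi\in[0,1]}rc^1_{stab}(e^{2\pi A_\xi},B,C),\qquad A_\xi:=A-i\xi.$$
   Context: $\mathbb T=\{z\in\mathbb C:|z|=1\}$. A strongly continuous semigroup $\{e^{tA}\}_{t\ge0}$ is hyperbolic if $\sigma(e^{tA})\cap\mathbb T=\emptyset$ for some (hence all) $t>0$. $\{e^{t(A+B\Delta C)}\}$ denotes the semigroup generated by $A+B\Delta C$ for $\Delta\in\mathcal L(Y,U)$. The constant dichotomy radius is $$rc_{dich}(\{e^{tA}\},B,C)=\sup\{r\ge0:\ \|\Delta\|_{\mathcal L(Y,U)}\le r\text{ implies }\sigma(e^{t(A+B\Delta C)})\cap\mathbb T=\emptyset\text{ for all }t>0\}.$$ For a generator $A$ with $1\in\rho(e^{2\pi A})$, the pointwise stability radius is $$rc^1_{stab}(e^{2\pi A},B,C)=\sup\{r>0:\ \|\Delta\|_{\mathcal L(Y,U)}\le r\Rightarrow1\in\rho(e^{2\pi(A+B\Delta C)})\}.$$ In both definitions the implication is required for all $\Delta\in\mathcal L(Y,U)$. *)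

(* Defs.v *)
From Stdlib Require Import Reals.
From Coquelicot Require Import Coquelicot.

Set Implicit Arguments.
Unset Strict Implicit.
Unset Printing Implicit Defensive.

Open Scope R_scope.

(* A complex Banach space is a [CompleteNormedModule C_AbsRing], and a bounded
   linear operator is a function satisfying Coquelicot's [is_linear], which
   includes boundedness. *)

(* The supremum of |T x| over the closed unit ball; it is finite when T is
   [is_linear]. *)
Definition op_norm {V W : NormedModule C_AbsRing} (T : V -> W) : Rbar :=
  Lub_Rbar (fun m : R => exists x : V, norm x <= 1 /\ m = norm (T x)).

Definition resolvent_set {X : CompleteNormedModule C_AbsRing} (T : X -> X)
    (l : Complex.C) : Prop :=
  exists Q : X -> X, is_linear Q /\
    forall x : X,
      Q (minus (scal (l : C_AbsRing) x) (T x)) = x /\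
      minus (scal (l : C_AbsRing) (Q x)) (T (Q x)) = x.

Definition spectrum {X : CompleteNormedModule C_AbsRing} (T : X -> X)
    (l : Complex.C) : Prop :=
  ~ resolvent_set T l.

Definition unit_circle (z : Complex.C) : Prop := Cmod z = 1.

Definition spectrum_avoids_circle {X : CompleteNormedModule C_AbsRing}
    (T : X -> X) : Prop :=
  forall z : Complex.C, ~ (spectrum T z /\ unit_circle z).

(* Semigroups are indexed by R; only the values at t >= 0 are meaningful. *)
Definition C0_semigroup {X : CompleteNormedModule C_AbsRing} (T : R -> X -> X)
    : Prop :=
  (forall t, 0 <= t -> is_linear (T t)) /\
  (forall x, T 0 x = x) /\
  (forall s t x, 0 <= s -> 0 <= t -> T (s + t) x = T s (T t x)) /\
  (forall x, filterlim (fun t => T t x) (at_right 0) (locally x)).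

Definition hyperbolic {X : CompleteNormedModule C_AbsRing} (T : R -> X -> X)
    : Prop :=
  exists t, 0 < t /\ spectrum_avoids_circle (T t).

(* A possibly unbounded operator; [op] is meaningful on [dom] only. *)
Record unbounded_op (X : CompleteNormedModule C_AbsRing) := UnboundedOp
  { dom : X -> Prop;
    op : X -> X }.

Definition generator_limit {X : CompleteNormedModule C_AbsRing}
    (T : R -> X -> X) (x y : X) : Prop :=
  filterlim (fun h : R => scal (RtoC (/ h) : C_AbsRing) (minus (T h x) x))
    (at_right 0) (locally y).

Definition is_generator {X : CompleteNormedModule C_AbsRing}
    (A : unbounded_op X) (T : R -> X -> X) : Prop :=
  (forall x, dom A x <-> exists y, generator_limit T x y) /\
  (forall x, dom A x -> generator_limit T x (op A x)).

(* [generates A T] says that T t = e^{tA} for t >= 0: a C0-semigroup is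
   determined, at t >= 0, by its generator. *)
Definition generates {X : CompleteNormedModule C_AbsRing}
    (A : unbounded_op X) (T : R -> X -> X) : Prop :=
  C0_semigroup T /\ is_generator A T.

(* A + B D C, with domain dom A. *)
Definition perturb {X U Y : CompleteNormedModule C_AbsRing}
    (A : unbounded_op X) (B : U -> X) (D : Y -> U) (C : X -> Y)
    : unbounded_op X :=
  UnboundedOp (dom A) (fun x => plus (op A x) (B (D (C x)))).

(* A_xi = A - i xi, with domain dom A. *)
Definition shift {X : CompleteNormedModule C_AbsRing}
    (A : unbounded_op X) (xi : R) : unbounded_op X :=
  UnboundedOp (dom A)
    (fun x => minus (op A x) (scal (Cmult Ci (RtoC xi) : C_AbsRing) x)).

(* Suprema and infima are taken in the extended reals, so that an unbounded
   set of admissible r gives p_infty. When A generates a C0-semigroup and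
   B, D, C are bounded, A + B D C generates exactly one C0-semigroup, so the
   quantification over S below ranges over e^{t (A + B D C)} alone. *)
Definition rc_dich {X U Y : CompleteNormedModule C_AbsRing}
    (A : unbounded_op X) (B : U -> X) (C : X -> Y) : Rbar :=
  Lub_Rbar (fun r : R => 0 <= r /\
    forall D : Y -> U, is_linear D -> Rbar_le (op_norm D) r ->
    forall S : R -> X -> X, generates (perturb A B D C) S ->
    forall t, 0 < t -> spectrum_avoids_circle (S t)).

Definition rc1_stab {X U Y : CompleteNormedModule C_AbsRing}
    (A : unbounded_op X) (B : U -> X) (C : X -> Y) : Rbar :=
  Lub_Rbar (fun r : R => 0 < r /\
    forall D : Y -> U, is_linear D -> Rbar_le (op_norm D) r ->
    forall S : R -> X -> X, generates (perturb A B D C) S ->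
    resolvent_set (S (2 * PI)) (RtoC 1)).

(* Main.v *)
Require Import Defs.
From Stdlib Require Import Reals Lra Lia List Classical IndefiniteDescription.
From Coquelicot Require Import Coquelicot.
Open Scope R_scope.

(** If [S] is generated by [A_xi + B D C], then [e^{i xi t} S(t)] is generated by
    [A + B D C], so the pointwise conditions for all [xi] in [0,1] say together
    that the unit circle lies in the resolvent set of [e^{2 pi (A + B D C)}].
    Three facts then give the equality of the radii.

    Hyperbolicity at one time implies hyperbolicity at all times. Given that
    [1 - z T(t0)] is invertible for [|z| = 1], the formula
    [(1 - z^2 W^2)^-1 = ((1 - z W)^-1 + (1 + z W)^-1) / 2] shows that the family
    [(1 - z T(2^k t0))^-1] is bounded uniformly in [k], with Lipschitz constant in
    the angle of [z] of order [2^-k]. Hence [T(tau) (1 - T(2 tau))^-1] tends to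
    [0] along [tau = 2^k t0], and a truncated Green function is an approximate
    inverse of [1 - T(t)]; no spectral projection is needed.

    For small [D] the semigroup generated by [A + B D C] is close to [e^{tA}] in
    operator norm: on the (dense) domain, [s |-> S(t - s) T(s) x] has right
    derivative [- S(t - s) B D C T(s) x]. So every pointwise radius is positive;
    without this, an empty set of admissible [r > 0] would have supremum
    [-infinity].

    The admissible sets are downward closed, so the supremum for the dichotomy
    radius is the infimum of the pointwise suprema. *)

(** * Linear identities in complex modules *)

Section ModuleIdentities.

Context {V : ModuleSpace C_Ring}.

Inductive vexpr :=
  | VVar (n : nat)
  | VZero
  | VPlus (a b : vexpr)
  | VOpp (a : vexpr)
  | VMinus (a b : vexpr)
  | VScal (c : Complex.C) (a : vexpr).

Fixpoint vden (env : list V) (e : vexpr) : V :=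
  match e with
  | VVar n => nth n env zero
  | VZero => zero
  | VPlus a b => plus (vden env a) (vden env b)
  | VOpp a => opp (vden env a)
  | VMinus a b => minus (vden env a) (vden env b)
  | VScal c a => scal (c : C_Ring) (vden env a)
  end.

Fixpoint vcoef (e : vexpr) (i : nat) : Complex.C :=
  match e with
  | VVar n => if Nat.eqb n i then RtoC 1 else RtoC 0
  | VZero => RtoC 0
  | VPlus a b => Cplus (vcoef a i) (vcoef b i)
  | VOpp a => Copp (vcoef a i)
  | VMinus a b => Cminus (vcoef a i) (vcoef b i)
  | VScal c a => Cmult c (vcoef a i)
  end.

Fixpoint lincomb (c : nat -> Complex.C) (env : list V) : V :=
  match env with
  | nil => zero
  | x :: l => plus (scal (c O : C_Ring) x) (lincomb (fun i => c (S i)) l)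
  end.

(** A recursive conjunction, so that on a concrete environment it computes to one equation in C per
    atom. *)
Fixpoint eq_upto (n : nat) (c d : nat -> Complex.C) : Prop :=
  match n with
  | O => True
  | S m => c O = d O /\ eq_upto m (fun i => c (S i)) (fun i => d (S i))
  end.

Lemma lincomb_ext (env : list V) (c d : nat -> Complex.C) :
  eq_upto (length env) c d -> lincomb c env = lincomb d env.
Proof.
revert c d; induction env as [|x l IH]; intros c d; simpl; [easy|].
intros [-> H]; f_equal; now apply IH.
Qed.

Lemma lincomb_zero (env : list V) : lincomb (fun _ => RtoC 0) env = zero.
Proof.
induction env as [|x l IH]; simpl; [easy|].
rewrite IH, plus_zero_r; exact (scal_zero_l x).
Qed.

Lemma lincomb_plus (env : list V) (c d : nat -> Complex.C) :
  lincomb (fun i => Cplus (c i) (d i)) env = plus (lincomb c env) (lincomb d env).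
Proof.
revert c d; induction env as [|x l IH]; intros c d; simpl.
  now rewrite plus_zero_l.
rewrite IH.
change (Cplus (c O) (d O)) with (plus (c O : C_Ring) (d O)).
rewrite scal_distr_r, <- !plus_assoc; f_equal.
rewrite !plus_assoc; f_equal; apply plus_comm.
Qed.

Lemma lincomb_scal (env : list V) (k : Complex.C) (c : nat -> Complex.C) :
  lincomb (fun i => Cmult k (c i)) env = scal (k : C_Ring) (lincomb c env).
Proof.
revert c; induction env as [|x l IH]; intros c; simpl.
  symmetry; exact (scal_zero_r (k : C_Ring)).
rewrite (IH (fun i => c (S i))), scal_distr_l; f_equal.
exact (eq_sym (scal_assoc (k : C_Ring) (c O : C_Ring) x)).
Qed.

Lemma lincomb_var (env : list V) (n : nat) :
  lincomb (fun i => if Nat.eqb n i then RtoC 1 else RtoC 0) env = nth n env zero.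
Proof.
revert n; induction env as [|x l IH]; intros [|n]; simpl; try easy.
  rewrite lincomb_zero, plus_zero_r; exact (scal_one x).
rewrite IH; etransitivity; [|apply plus_zero_l].
f_equal; exact (scal_zero_l x).
Qed.

Lemma vden_lincomb (env : list V) (e : vexpr) :
  vden env e = lincomb (vcoef e) env.
Proof.
assert (Hopp : forall c : nat -> Complex.C,
    lincomb (fun i => Copp (c i)) env = opp (lincomb c env)).
{ intros c; rewrite <- (scal_opp_one (lincomb c env)).
  rewrite <- (lincomb_scal env (opp (one : C_Ring)) c).
  apply lincomb_ext.
  generalize (length env); intros n; revert c; induction n as [|n IH].
    easy.
  intros c; simpl; split; [|exact (IH (fun i => c (S i)))].
  unfold opp, one; simpl; ring. }
induction e; simpl.
- now rewrite lincomb_var.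
- now rewrite lincomb_zero.
- now rewrite lincomb_plus, IHe1, IHe2.
- now rewrite Hopp, IHe.
- unfold Cminus; rewrite (lincomb_plus env (vcoef e1) (fun i => Copp (vcoef e2 i))).
  now rewrite Hopp, IHe1, IHe2.
- now rewrite lincomb_scal, IHe.
Qed.

Lemma vden_eq (env : list V) (e f : vexpr) :
  eq_upto (length env) (vcoef e) (vcoef f) -> vden env e = vden env f.
Proof. intros H; rewrite !vden_lincomb; now apply lincomb_ext. Qed.

End ModuleIdentities.

(* [vec_reflect] turns an equation between linear combinations of atoms into one
   equation in C per atom. *)
Ltac vec_index x env :=
  lazymatch env with
  | x :: _ => constr:(O)
  | _ :: ?l => let n := vec_index x l in constr:(S n)
  end.

Ltac vec_mem x env :=
  lazymatch env with
  | nil => constr:(false)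
  | x :: _ => constr:(true)
  | _ :: ?l => vec_mem x l
  end.

Ltac vec_atoms e env :=
  lazymatch e with
  | @plus _ ?a ?b => let env' := vec_atoms a env in vec_atoms b env'
  | @minus _ ?a ?b => let env' := vec_atoms a env in vec_atoms b env'
  | @opp _ ?a => vec_atoms a env
  | @scal _ _ _ ?a => vec_atoms a env
  | @zero _ => env
  | _ => lazymatch vec_mem e env with
         | true => env
         | false => constr:(e :: env)
         end
  end.

Ltac vec_reify e env :=
  lazymatch e with
  | @plus _ ?a ?b =>
      let a' := vec_reify a env in let b' := vec_reify b env in constr:(VPlus a' b')
  | @minus _ ?a ?b =>
      let a' := vec_reify a env in let b' := vec_reify b env in constr:(VMinus a' b')
  | @opp _ ?a => let a' := vec_reify a env in constr:(VOpp a')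
  | @scal _ _ ?c ?a => let a' := vec_reify a env in constr:(VScal c a')
  | @zero _ => constr:(VZero)
  | _ => let n := vec_index e env in constr:(VVar n)
  end.

Ltac vec_reflect :=
  lazymatch goal with
  | |- @eq ?T ?a ?b =>
      let env := vec_atoms a (@nil T) in
      let env := vec_atoms b env in
      let a' := vec_reify a env in
      let b' := vec_reify b env in
      refine (vden_eq env a' b' _);
      cbn [length eq_upto vcoef Nat.eqb]; repeat split
  end.

Ltac cnorm :=
  unfold one, opp, mult, plus, minus, zero; simpl.

Ltac vec := vec_reflect; try (cnorm; ring).

(** * Bounded operators *)

(* Coquelicot's lemmas, restated so that all operations go through the
   [CompleteNormedModule] structure: [rewrite] and [lra] do not identify the
   convertible terms obtained through [NormedModule]. *)
Section CompleteModules.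

Context {V W : CompleteNormedModule C_AbsRing}.

Lemma norm_plus_le (x y : V) : norm (plus x y) <= norm x + norm y.
Proof. exact (norm_triangle x y). Qed.

Lemma norm_opp_eq (x : V) : norm (opp x) = norm x.
Proof. exact (norm_opp x). Qed.

Lemma norm_zero_eq : norm (zero : V) = 0.
Proof. exact norm_zero. Qed.

Lemma norm_0_eq_zero (x : V) : norm x = 0 -> x = zero.
Proof. exact (norm_eq_zero x). Qed.

Lemma minus_0_r (x : V) : (minus x (zero : V) : V) = x.
Proof. exact (minus_zero_r x). Qed.

Lemma minus_self (x : V) : (minus x x : V) = zero.
Proof. exact (minus_eq_zero x). Qed.

Lemma filterlim_norm_iff {T : Type} {F : (T -> Prop) -> Prop} {FF : Filter F}
    (f : T -> V) (y : V) :
  filterlim f F (locally y) <->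
  forall eps, 0 < eps -> F (fun x => norm (minus (f x) y) < eps).
Proof.
apply (iff_trans (filterlim_locally_ball_norm f y)); split.
  intros H e He; exact (H (mkposreal e He)).
intros H e; exact (H e (cond_pos e)).
Qed.

Lemma op_plus (f : V -> W) (x y : V) :
  is_linear f -> f (plus x y) = plus (f x) (f y).
Proof. intros Hf; exact (linear_plus f Hf x y). Qed.

Lemma op_minus (f : V -> W) (x y : V) :
  is_linear f -> f (minus x y) = minus (f x) (f y).
Proof. exact (linear_minus f x y). Qed.

Lemma op_scal (f : V -> W) (c : Complex.C) (x : V) :
  is_linear f -> f (scal (c : C_AbsRing) x) = scal (c : C_AbsRing) (f x).
Proof. intros Hf; exact (linear_scal f Hf c x). Qed.

Lemma op_zero (f : V -> W) : is_linear f -> f zero = zero.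
Proof. exact (linear_zero f). Qed.

End CompleteModules.

Lemma norm_minus_le {V : CompleteNormedModule C_AbsRing} (x y : V) :
  norm (minus x y) <= norm x + norm y.
Proof. rewrite <- (norm_opp_eq y); apply norm_plus_le. Qed.

Lemma norm_minus_sym {V : CompleteNormedModule C_AbsRing} (x y : V) :
  norm (minus x y) = norm (minus y x).
Proof. rewrite <- norm_opp_eq; f_equal; vec. Qed.

Lemma norm_minus_triangle {V : CompleteNormedModule C_AbsRing} (y x z : V) :
  norm (minus x z) <= norm (minus x y) + norm (minus y z).
Proof. rewrite (minus_trans y x z); apply norm_plus_le. Qed.

Lemma norm_le_minus {V : CompleteNormedModule C_AbsRing} (x y : V) :
  norm x <= norm y + norm (minus x y).
Proof.
replace x with (plus y (minus x y)) at 1 by vec; apply norm_plus_le.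
Qed.

Lemma norm_minus_self {V : CompleteNormedModule C_AbsRing} (x : V) : norm (minus x x) = 0.
Proof. rewrite minus_self; exact norm_zero_eq. Qed.

Lemma minus_eq_0 {V : CompleteNormedModule C_AbsRing} (x y : V) :
  norm (minus x y) <= 0 -> x = y.
Proof.
intros H.
assert (E : minus x y = zero).
{ apply norm_0_eq_zero; generalize (norm_ge_0 (minus x y)); lra. }
replace x with (plus (minus x y) y) by vec.
rewrite E; vec.
Qed.

(** The axiom of normed modules is an inequality; applying it also to the inverse of [c] gives
    equality. *)
Lemma norm_scal_C {V : CompleteNormedModule C_AbsRing} (c : Complex.C) (x : V) :
  norm (scal (c : C_AbsRing) x) = Cmod c * norm x.
Proof.
apply Rle_antisym; [exact (norm_scal (c : C_AbsRing) x)|].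
destruct (Req_dec (Cmod c) 0) as [H0|H0].
  rewrite H0, Rmult_0_l; apply norm_ge_0.
assert (Hc : c <> RtoC 0) by (intros ->; now rewrite Cmod_0 in H0).
assert (Hp : 0 < Cmod c) by (generalize (Cmod_ge_0 c); lra).
assert (E : x = scal (Cinv c : C_AbsRing) (scal (c : C_AbsRing) x))
  by (vec_reflect; cnorm; field; exact Hc).
rewrite E at 1.
apply Rle_trans with (Cmod c * (Cmod (Cinv c) * norm (scal (c : C_AbsRing) x))).
  apply Rmult_le_compat_l; [lra|exact (norm_scal (Cinv c : C_AbsRing) _)].
rewrite Cmod_inv by exact Hc; apply Req_le; field; exact H0.
Qed.

(** * Geometric convergence in Banach spaces *)

Lemma half_pow_small (c e : R) : 0 < e -> exists n : nat, c * (/ 2) ^ n < e.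
Proof.
intros He.
destruct (Rle_lt_dec c 0) as [Hc|Hc].
  exists O; simpl; lra.
destruct (pow_lt_1_zero (/ 2)) with (y := e / c) as [n Hn].
- rewrite Rabs_right; lra.
- now apply Rdiv_lt_0_compat.
- exists n; specialize (Hn n (le_n n)).
  rewrite Rabs_right in Hn by (apply Rle_ge, pow_le; lra).
  apply Rmult_lt_compat_l with (r := c) in Hn; [|exact Hc].
  replace (c * (e / c)) with e in Hn by (field; lra); exact Hn.
Qed.

Lemma geometric_dist {V : CompleteNormedModule C_AbsRing} (u : nat -> V) (c : R) :
  (forall n, norm (minus (u (S n)) (u n)) <= c * (/ 2) ^ n) ->
  forall n, norm (minus (u n) (u O)) <= 2 * c.
Proof.
intros Hu.
assert (Hc : 0 <= c).
{ generalize (Rle_trans _ _ _ (norm_ge_0 _) (Hu O)); simpl; lra. }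
(* The gap [2 * c * (/ 2) ^ n] is the tail of the geometric series; keeping it lets the induction
   close. *)
assert (H : forall n, norm (minus (u n) (u O)) <= 2 * c - 2 * c * (/ 2) ^ n).
{ induction n as [|n IH].
    rewrite norm_minus_self; simpl; lra.
  eapply Rle_trans; [apply (norm_minus_triangle (u n))|].
  specialize (Hu n); simpl pow; lra. }
intros n; specialize (H n).
assert (0 <= 2 * c * (/ 2) ^ n) by (apply Rmult_le_pos; [lra|apply pow_le; lra]).
lra.
Qed.

Lemma geometric_limit {X : CompleteNormedModule C_AbsRing} (u : nat -> X) (c : R) :
  (forall n, norm (minus (u (S n)) (u n)) <= c * (/ 2) ^ n) ->
  exists l, forall n, norm (minus l (u n)) <= 2 * c * (/ 2) ^ n.
Proof.
intros Hu.
assert (Hc : 0 <= c).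
{ generalize (Rle_trans _ _ _ (norm_ge_0 _) (Hu O)); simpl; lra. }
assert (Hd : forall n m, norm (minus (u (m + n)%nat) (u n)) <= 2 * c * (/ 2) ^ n).
{ intros n m.
  apply Rle_trans with (2 * (c * (/ 2) ^ n)); [|apply Req_le; ring].
  apply (geometric_dist (fun m => u (m + n)%nat)).
  intros k; eapply Rle_trans; [apply Hu|].
  rewrite pow_add; apply Req_le; ring. }
destruct (proj1 (filterlim_locally_cauchy (F := eventually) u)) as [l Hl].
{ intros eps.
  destruct (half_pow_small (4 * c) eps) as [N HN]; [apply cond_pos|].
  exists (fun n => (N <= n)%nat); split; [now exists N|].
  intros n m Hn Hm; apply (norm_compat1 (u n) (u m)).
  eapply Rle_lt_trans; [apply (norm_minus_triangle (u N))|].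
  rewrite (norm_minus_sym (u N)).
  generalize (Hd N (n - N)%nat) (Hd N (m - N)%nat).
  rewrite !Nat.sub_add by easy; lra. }
exists l; intros n; apply le_epsilon; intros e He.
destruct (proj1 (filterlim_norm_iff u l) Hl e He) as [N HN].
specialize (HN (N + n)%nat (Nat.le_add_r N n)).
eapply Rle_trans; [apply (norm_minus_triangle (u (N + n)%nat))|].
rewrite (norm_minus_sym l); generalize (Hd n N); lra.
Qed.

(** An operator bound as a plain inequality, avoiding the supremum in the extended reals; [K] need
    not be optimal. *)
Definition bounded_by {V W : CompleteNormedModule C_AbsRing} (K : R) (f : V -> W) : Prop :=
  forall x, norm (f x) <= K * norm x.

Lemma is_linear_bounded {V W : CompleteNormedModule C_AbsRing} (f : V -> W) :
  is_linear f -> exists K, 0 < K /\ bounded_by K f.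
Proof. exact (linear_norm f). Qed.

Lemma bounded_by_le {V W : CompleteNormedModule C_AbsRing} (f : V -> W) (K L : R) :
  K <= L -> bounded_by K f -> bounded_by L f.
Proof.
intros H Hf x; eapply Rle_trans; [apply Hf|].
apply Rmult_le_compat_r; [apply norm_ge_0|exact H].
Qed.

Lemma bounded_by_comp {V W Z : CompleteNormedModule C_AbsRing} (f : V -> W) (g : W -> Z)
    (K L : R) :
  0 <= L -> bounded_by K f -> bounded_by L g -> bounded_by (L * K) (fun x => g (f x)).
Proof.
intros HL Hf Hg x; eapply Rle_trans; [apply Hg|].
rewrite Rmult_assoc; apply Rmult_le_compat_l; [exact HL|apply Hf].
Qed.

Lemma is_linear_plus_fun {V W : CompleteNormedModule C_AbsRing} (f g : V -> W) :
  is_linear f -> is_linear g -> is_linear (fun x => plus (f x) (g x)).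
Proof.
intros Hf Hg.
exact (is_linear_comp _ _ (is_linear_prod f g Hf Hg) is_linear_plus).
Qed.

Lemma is_linear_scal_fun {V W : CompleteNormedModule C_AbsRing} (c : Complex.C) (f : V -> W) :
  is_linear f -> is_linear (fun x => scal (c : C_AbsRing) (f x)).
Proof.
intros Hf; apply (is_linear_comp f (scal (c : C_AbsRing))); [exact Hf|].
apply is_linear_scal_r, Cmult_comm.
Qed.

Lemma is_linear_minus_fun {V W : CompleteNormedModule C_AbsRing} (f g : V -> W) :
  is_linear f -> is_linear g -> is_linear (fun x => minus (f x) (g x)).
Proof.
intros Hf Hg; apply (is_linear_plus_fun f (fun x => opp (g x))); [exact Hf|].
exact (is_linear_comp _ _ Hg is_linear_opp).
Qed.

(** * Invertibility and Neumann iteration *)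

Definition inverse_op {X : CompleteNormedModule C_AbsRing} (G Q : X -> X) : Prop :=
  is_linear Q /\ (forall x, Q (G x) = x) /\ (forall x, G (Q x) = x).

Definition invertible {X : CompleteNormedModule C_AbsRing} (G : X -> X) : Prop :=
  exists Q, inverse_op G Q.

Lemma resolvent_set_invertible {X : CompleteNormedModule C_AbsRing} (T : X -> X)
    (l : Complex.C) :
  resolvent_set T l <-> invertible (fun x => minus (scal (l : C_AbsRing) x) (T x)).
Proof.
split; intros [Q [HQ H]]; exists Q; split; try exact HQ.
  split; intros x; apply H.
intros x; split; apply H.
Qed.

(** The lower bound makes [G] injective, so a pointwise choice of preimages is linear, and it also
    bounds the inverse; no open mapping theorem is involved. *)
Lemma bijective_invertible {X : CompleteNormedModule C_AbsRing} (G : X -> X) (M : R) :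
  is_linear G -> (forall x, norm x <= M * norm (G x)) ->
  (forall y, exists x, G x = y) -> invertible G.
Proof.
intros HG HM Hs.
destruct (functional_choice _ Hs) as [Q HQ].
assert (inj : forall x y, G x = G y -> x = y).
{ intros x y E; apply minus_eq_0.
  eapply Rle_trans; [apply HM|].
  rewrite (op_minus G), E, norm_minus_self by exact HG; lra. }
exists Q; split; [|split; [intros x; apply inj, HQ|exact HQ]].
apply Build_is_linear.
- intros x y; apply inj; rewrite (op_plus G), !HQ by exact HG; easy.
- intros k x; apply inj; rewrite (op_scal G), !HQ by exact HG; easy.
(* [is_linear] asks for a positive bound, while [M] may be nonpositive. *)
- exists (Rmax M 1); split.
    apply Rlt_le_trans with (2 := Rmax_r _ _); lra.
  intros x; eapply Rle_trans; [apply HM|]; rewrite HQ.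
  apply Rmult_le_compat_r; [apply norm_ge_0|apply Rmax_l].
Qed.

(** The iteration [u (S n) = u n + (y - H (u n))] halves the residual [y - H (u n)] at every step,
    hence converges to a preimage of [y]. *)
Lemma near_identity_surjective {X : CompleteNormedModule C_AbsRing} (H : X -> X) :
  is_linear H -> (forall x, norm (minus (H x) x) <= / 2 * norm x) ->
  forall y, exists x, H x = y.
Proof.
intros HL Hh y.
pose (u := fix u (n : nat) : X :=
  match n with O => zero | S m => plus (u m) (minus y (H (u m))) end).
assert (u0 : u O = zero) by easy.
assert (uS : forall n, u (S n) = plus (u n) (minus y (H (u n)))) by easy.
clearbody u.
assert (Hr : forall n, norm (minus y (H (u n))) <= norm y * (/ 2) ^ n).
{ induction n as [|n IH].
    rewrite u0, (op_zero H HL), minus_0_r; simpl; lra.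
  rewrite uS, (op_plus H) by exact HL.
  replace (minus y (plus (H (u n)) (H (minus y (H (u n))))))
    with (opp (minus (H (minus y (H (u n)))) (minus y (H (u n))))) by vec.
  rewrite norm_opp_eq; eapply Rle_trans; [apply Hh|]; simpl pow; lra. }
destruct (geometric_limit u (norm y)) as [l Hl].
  intros n; replace (minus (u (S n)) (u n)) with (minus y (H (u n))); [apply Hr|].
  rewrite uS; vec.
exists l; symmetry; apply minus_eq_0, le_epsilon; intros e He.
destruct (is_linear_bounded H HL) as [K [HK0 HK]].
destruct (half_pow_small (norm y + K * (2 * norm y)) e He) as [n Hn].
eapply Rle_trans; [apply (norm_minus_triangle (H (u n)))|].
rewrite <- (op_minus H) by exact HL; rewrite (norm_minus_sym y).
generalize (HK (minus (u n) l)) (Hr n); rewrite (norm_minus_sym y), (norm_minus_sym (u n)).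
specialize (Hl n); apply Rmult_le_compat_l with (r := K) in Hl; lra.
Qed.

(** [Q G] close to the identity bounds [G] from below, with constant [2 * K]; [G Q] close to the
    identity makes [G] surjective. *)
Lemma approximate_inverse_invertible {X : CompleteNormedModule C_AbsRing}
    (G Q : X -> X) :
  is_linear G -> is_linear Q ->
  (forall x, norm (minus (Q (G x)) x) <= / 2 * norm x) ->
  (forall x, norm (minus (G (Q x)) x) <= / 2 * norm x) ->
  invertible G.
Proof.
intros HG HQ HQG HGQ.
destruct (is_linear_bounded Q HQ) as [K [HK0 HK]].
apply bijective_invertible with (2 * K); [exact HG| |].
- intros x; generalize (HQG x) (HK (G x)) (norm_le_minus x (Q (G x))).
  rewrite (norm_minus_sym x); lra.
- intros y.
  destruct (near_identity_surjective (fun x => G (Q x))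
    (is_linear_comp _ _ HQ HG) HGQ y) as [x Hx].
  now exists (Q x).
Qed.

(** Banach-Steinhaus by nested balls: if no uniform bound exists, every ball contains a smaller one
    on which [norm (B i y) >= n] for some [i]. The common point of such balls violates pointwise
    boundedness. *)
Lemma uniform_boundedness {X V : CompleteNormedModule C_AbsRing} (I : Type)
    (B : I -> X -> V) :
  (forall i, is_linear (B i)) ->
  (forall x, exists c, forall i, norm (B i x) <= c) ->
  exists K, 0 < K /\ forall i, bounded_by K (B i).
Proof.
intros HB Hpt; apply NNPP; intros Hno.
assert (Hball : forall (p : X * posreal) (n : nat), exists q : X * posreal,
  norm (minus (fst q) (fst p)) <= snd p / 4 /\ snd q <= snd p / 2 /\
  exists i, forall y : X, norm (minus y (fst q)) <= snd q -> INR n <= norm (B i y)).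
{ intros [a r] n; simpl; apply NNPP; intros Hq; apply Hno.
  assert (Hr : 0 < r) by apply cond_pos.
  (* By continuity a value above [n] would persist on a small ball around [y], which is the ball
     assumed not to exist. *)
  assert (Hin : forall i y, norm (minus y a) <= r / 4 -> norm (B i y) <= INR n).
  { intros i y Hy; apply Rnot_lt_le; intros Hlt; apply Hq.
    destruct (is_linear_bounded (B i) (HB i)) as [K [HK0 HK]].
    assert (Hs : 0 < Rmin (r / 2) ((norm (B i y) - INR n) / K)).
    { apply Rmin_pos; [lra|apply Rdiv_lt_0_compat; lra]. }
    exists (y, mkposreal _ Hs); simpl; split; [exact Hy|].
    split; [apply Rmin_l|exists i; intros z Hz].
    assert (H1 : norm (B i (minus y z)) <= norm (B i y) - INR n).
    { eapply Rle_trans; [apply HK|].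
      rewrite norm_minus_sym.
      apply Rle_trans with (K * ((norm (B i y) - INR n) / K)).
        apply Rmult_le_compat_l; [lra|].
        eapply Rle_trans; [exact Hz|apply Rmin_r].
      apply Req_le; field; lra. }
    rewrite (op_minus (B i) _ _ (HB i)) in H1.
    generalize (norm_le_minus (B i y) (B i z)); lra. }
  (* A vector of norm [r / 4] is a difference of two points of the ball, so [B i] is at most
     [2 * INR n] there; this rescales to [8 * INR n / r], and the 1 makes the bound positive. *)
  exists (8 * INR n / r + 1).
  assert (Hn : 0 <= INR n) by apply pos_INR.
  assert (H8 : 0 <= 8 * INR n / r) by (apply Rdiv_le_0_compat; lra).
  split; [lra|].
  intros i x; destruct (Req_dec (norm x) 0) as [E|E].
    apply (norm_0_eq_zero x) in E; subst x.
    rewrite (op_zero (B i) (HB i)), !norm_zero_eq; lra.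
  assert (Hx : 0 < norm x) by (generalize (norm_ge_0 x); lra).
  set (c := r / 4 / norm x).
  assert (Hc : 0 < c) by (unfold c; apply Rdiv_lt_0_compat; lra).
  assert (Hcx : norm (scal (RtoC c : C_AbsRing) x) = r / 4).
  { rewrite norm_scal_C, Cmod_R, Rabs_right by lra.
    unfold c; field; lra. }
  assert (Ha := Hin i a).
  rewrite norm_minus_self in Ha; specialize (Ha ltac:(lra)).
  assert (Hax := Hin i (plus a (scal (RtoC c : C_AbsRing) x))).
  replace (minus (plus a (scal (RtoC c : C_AbsRing) x)) a)
    with (scal (RtoC c : C_AbsRing) x) in Hax by vec.
  specialize (Hax ltac:(lra)).
  assert (H2 : norm (B i (scal (RtoC c : C_AbsRing) x)) <= 2 * INR n).
  { replace (scal (RtoC c : C_AbsRing) x)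
      with (minus (plus a (scal (RtoC c : C_AbsRing) x)) a) by vec.
    rewrite (op_minus (B i) _ _ (HB i)).
    generalize (norm_minus_le (B i (plus a (scal (RtoC c : C_AbsRing) x))) (B i a)); lra. }
  rewrite (op_scal (B i) _ _ (HB i)), norm_scal_C, Cmod_R, Rabs_right in H2 by lra.
  apply Rmult_le_reg_l with c; [exact Hc|].
  eapply Rle_trans; [exact H2|].
  replace (c * ((8 * INR n / r + 1) * norm x)) with (2 * INR n + r / 4)
    by (unfold c; field; lra).
  lra. }
destruct (functional_choice (fun (pn : (X * posreal) * nat) (q : X * posreal) =>
  norm (minus (fst q) (fst (fst pn))) <= snd (fst pn) / 4 /\
  snd q <= snd (fst pn) / 2 /\
  exists i, forall y : X, norm (minus y (fst q)) <= snd q -> INR (snd pn) <= norm (B i y)))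
  as [next Hnext].
{ intros [p n]; apply Hball. }
pose (s := fix s (n : nat) : X * posreal :=
  match n with O => (zero, mkposreal 1 Rlt_0_1) | S m => next (s m, m) end).
pose (a n := fst (s n)); pose (r n := pos (snd (s n))).
assert (Hs : forall n, norm (minus (a (S n)) (a n)) <= r n / 4 /\ r (S n) <= r n / 2 /\
  exists i, forall y : X, norm (minus y (a (S n))) <= r (S n) -> INR n <= norm (B i y)).
{ intros n; exact (Hnext (s n, n)). }
assert (Hr : forall n m, r (m + n)%nat <= r n * (/ 2) ^ m).
{ intros n m; induction m as [|m IH]; simpl; [lra|].
  generalize (proj1 (proj2 (Hs (m + n)%nat))); simpl in IH; lra. }
assert (Hd : forall n m,
  norm (minus (a (S (m + n))) (a (m + n)%nat)) <= r n / 4 * (/ 2) ^ m).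
{ intros n m; generalize (proj1 (Hs (m + n)%nat)) (Hr n m); lra. }
destruct (geometric_limit a (r O / 4)) as [l Hl].
  intros n; generalize (Hd O n); now rewrite Nat.add_0_r.
(* Beyond stage [n] the centres drift by at most [r n / 2] in total, so the limit stays in every
   ball. *)
assert (Hin : forall n, norm (minus l (a n)) <= r n).
{ intros n; apply le_epsilon; intros e He.
  destruct (half_pow_small (2 * (r O / 4)) e He) as [m Hm].
  eapply Rle_trans; [apply (norm_minus_triangle (a (m + n)%nat))|].
  assert (Hrn : 0 < r n) by apply cond_pos.
  generalize (geometric_dist (fun m => a (m + n)%nat) (r n / 4) (Hd n) m); simpl.
  specialize (Hl (m + n)%nat); rewrite pow_add in Hl.
  assert ((/ 2) ^ m * (/ 2) ^ n <= (/ 2) ^ m).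
  { rewrite <- (Rmult_1_r ((/ 2) ^ m)) at 2; apply Rmult_le_compat_l.
      apply pow_le; lra.
    rewrite <- (pow1 n); apply pow_incr; lra. }
  assert (Hr0 : 0 < r O) by apply cond_pos.
  apply Rmult_le_compat_l with (r := 2 * (r O / 4)) in H; lra. }
destruct (Hpt l) as [c Hc].
destruct (INR_unbounded c) as [n Hn].
destruct (Hs n) as [_ [_ [i Hi]]].
generalize (Hi l (Hin (S n))) (Hc i); lra.
Qed.

(** * Strongly continuous semigroups *)

Lemma at_right_0_iff (P : R -> Prop) :
  at_right 0 P <-> exists d, 0 < d /\ forall h, 0 < h < d -> P h.
Proof.
split.
- intros [d Hd]; exists d; split; [apply cond_pos|].
  intros h Hh; apply Hd; [|lra].
  apply (norm_compat1 0 h); unfold minus, plus, opp, norm; simpl; unfold abs; simpl.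
  rewrite Rabs_right; lra.
- intros [d [Hd H]]; exists (mkposreal d Hd); intros h Hb Hh.
  apply H; split; [exact Hh|].
  change (Rabs (h + - 0) < d) in Hb; rewrite Rabs_right in Hb; lra.
Qed.

Lemma filterlim_at_right_0 {V : CompleteNormedModule C_AbsRing} (f : R -> V) (y : V) :
  filterlim f (at_right 0) (locally y) <->
  forall eps, 0 < eps -> exists d, 0 < d /\
    forall h, 0 < h < d -> norm (minus (f h) y) < eps.
Proof.
apply (iff_trans (filterlim_norm_iff f y)); split; intros H eps He;
  apply at_right_0_iff, H, He.
Qed.

Lemma finite_bound (f : nat -> R) (N : nat) :
  exists c, forall n, (n < N)%nat -> f n <= c.
Proof.
induction N as [|N [c Hc]]; [exists 0; lia|].
exists (Rmax c (f N)); intros n Hn.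
destruct (Nat.eq_dec n N) as [->|Hne]; [apply Rmax_r|].
apply Rle_trans with c; [apply Hc; lia|apply Rmax_l].
Qed.

Section Semigroups.

Context {X : CompleteNormedModule C_AbsRing} {T : R -> X -> X}.
Hypothesis HT : C0_semigroup T.

Lemma semigroup_linear t : 0 <= t -> is_linear (T t).
Proof. exact (proj1 HT t). Qed.

Lemma semigroup_0 x : T 0 x = x.
Proof. exact (proj1 (proj2 HT) x). Qed.

Lemma semigroup_plus s t x : 0 <= s -> 0 <= t -> T (s + t) x = T s (T t x).
Proof. exact (proj1 (proj2 (proj2 HT)) s t x). Qed.

Lemma semigroup_comm s t x : 0 <= s -> 0 <= t -> T s (T t x) = T t (T s x).
Proof.
intros Hs Ht; rewrite <- !semigroup_plus by easy; now rewrite Rplus_comm.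
Qed.

Lemma semigroup_right_continuous x eps :
  0 < eps -> exists d, 0 < d /\ forall h, 0 < h < d -> norm (minus (T h x) x) < eps.
Proof.
exact (proj1 (filterlim_at_right_0 _ x) (proj2 (proj2 (proj2 HT)) x) eps).
Qed.

(** Otherwise there are [s n] tending to 0 with [T (s n)] not bounded by [n + 1]; right continuity
    makes every orbit bounded along [s n], against uniform boundedness. *)
Lemma semigroup_bounded_near_0 :
  exists d K, 0 < d /\ 0 < K /\ forall s, 0 <= s <= d -> bounded_by K (T s).
Proof.
apply NNPP; intros Hno.
assert (Hs : forall n : nat, exists s,
    0 <= s <= / (INR n + 1) /\ ~ bounded_by (INR n + 1) (T s)).
{ intros n; apply NNPP; intros Hn; apply Hno.
  assert (Hpos := pos_INR n).
  exists (/ (INR n + 1)), (INR n + 1); repeat split; [|lra|].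
    apply Rinv_0_lt_compat; lra.
  intros s Hs; apply NNPP; intros Hb; apply Hn; now exists s. }
destruct (functional_choice _ Hs) as [s Hsn].
destruct (uniform_boundedness nat (fun n => T (s n))) as [K [HK0 HK]].
- intros n; apply semigroup_linear, Hsn.
- intros x; destruct (semigroup_right_continuous x 1 Rlt_0_1) as [d [Hd Hx]].
  destruct (INR_unbounded (/ d)) as [N HN].
  (* Indices below [N] need a separate bound, since their [s n] may exceed [d]. *)
  destruct (finite_bound (fun n => norm (T (s n) x)) N) as [c Hc].
  exists (Rmax c (norm x + 1)); intros n.
  destruct (Nat.lt_ge_cases n N) as [Hlt|Hge].
    eapply Rle_trans; [now apply Hc|apply Rmax_l].
  eapply Rle_trans; [|apply Rmax_r].
  destruct (Hsn n) as [[H0 H1] _].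
  destruct (Req_dec (s n) 0) as [->|Hne]; [rewrite semigroup_0; lra|].
  assert (Hsd : s n < d).
  { apply Rle_lt_trans with (1 := H1).
    rewrite <- (Rinv_inv d).
    assert (0 < / d) by now apply Rinv_0_lt_compat.
    apply le_INR in Hge; apply Rinv_lt_contravar; [|lra].
    apply Rmult_lt_0_compat; lra. }
  specialize (Hx (s n) ltac:(lra)).
  generalize (norm_le_minus (T (s n) x) x); lra.
- destruct (INR_unbounded K) as [n Hn].
  apply (proj2 (Hsn n)), bounded_by_le with K; [lra|apply HK].
Qed.

Lemma semigroup_locally_bounded t :
  exists K, 0 < K /\ forall s, 0 <= s <= t -> bounded_by K (T s).
Proof.
destruct semigroup_bounded_near_0 as [d [K [Hd [HK0 HK]]]].
assert (H : forall n : nat, exists L, 0 < L /\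
    forall s, 0 <= s <= INR n * d -> bounded_by L (T s)).
{ induction n as [|n [L [HL0 HL]]].
    exists K; split; [exact HK0|]; simpl; intros s Hs; apply HK; lra.
  exists (Rmax L (K * L)); split; [apply Rlt_le_trans with (2 := Rmax_l _ _); lra|].
  intros s Hs; rewrite S_INR in Hs.
  assert (Hnd : 0 <= INR n * d) by (apply Rmult_le_pos; [apply pos_INR|lra]).
  destruct (Rle_lt_dec s (INR n * d)) as [Hle|Hlt].
    apply bounded_by_le with L; [apply Rmax_l|apply HL; lra].
  apply bounded_by_le with (K * L); [apply Rmax_r|].
  intros x; replace s with ((s - INR n * d) + INR n * d) by ring.
  rewrite semigroup_plus by lra.
  apply (bounded_by_comp (T (INR n * d)) (T (s - INR n * d)) L K); [lra| |].
    apply HL; lra.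
  apply HK; lra. }
destruct (INR_unbounded (t / d)) as [n Hn].
destruct (H n) as [L [HL0 HL]]; exists L; split; [exact HL0|].
intros s Hs; apply HL; split; [lra|].
apply Rle_trans with (1 := proj2 Hs).
apply Rmult_lt_compat_r with (r := d) in Hn; [|exact Hd].
unfold Rdiv in Hn; rewrite Rmult_assoc, Rinv_l in Hn; lra.
Qed.

(** A partial sum of the Neumann series for the inverse of [1 - T t]. *)
Fixpoint orbit_sum (t : R) (n : nat) (x : X) : X :=
  match n with
  | O => zero
  | S m => plus (orbit_sum t m x) (T (INR m * t) x)
  end.

Lemma orbit_sum_linear t n : 0 <= t -> is_linear (orbit_sum t n).
Proof.
intros Ht; induction n as [|n IH]; [exact is_linear_zero|].
apply (is_linear_plus_fun (orbit_sum t n) (T (INR n * t))); [exact IH|].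
apply semigroup_linear, Rmult_le_pos; [apply pos_INR|exact Ht].
Qed.

Lemma orbit_sum_comm t n x :
  0 <= t -> orbit_sum t n (T t x) = T t (orbit_sum t n x).
Proof.
intros Ht; assert (HL := semigroup_linear t Ht).
induction n as [|n IH]; cbn [orbit_sum].
  symmetry; exact (op_zero (T t) HL).
assert (Hn : 0 <= INR n * t) by (apply Rmult_le_pos; [apply pos_INR|exact Ht]).
rewrite (op_plus (T t)), IH, semigroup_comm by easy; easy.
Qed.

Lemma orbit_sum_telescope t n x :
  0 <= t ->
  minus (orbit_sum t n x) (T t (orbit_sum t n x)) = minus x (T (INR n * t) x).
Proof.
intros Ht; assert (HL := semigroup_linear t Ht).
induction n as [|n IH].
  cbn [orbit_sum]; rewrite (op_zero (T t) HL); simpl INR.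
  rewrite Rmult_0_l, semigroup_0; vec.
cbn [orbit_sum].
assert (Hn : 0 <= INR n * t) by (apply Rmult_le_pos; [apply pos_INR|exact Ht]).
rewrite (op_plus (T t)) by easy.
rewrite <- semigroup_plus by easy.
rewrite S_INR; replace ((INR n + 1) * t) with (t + INR n * t) by ring.
transitivity (plus (minus (orbit_sum t n x) (T t (orbit_sum t n x)) : X)
  (minus (T (INR n * t) x) (T (t + INR n * t) x))); [vec|].
rewrite IH; vec.
Qed.

End Semigroups.

(** * Hyperbolicity at all times *)

Definition expi (a : R) : Complex.C := (cos a, sin a).

Lemma Cmod_expi a : Cmod (expi a) = 1.
Proof.
unfold Cmod, expi; simpl fst; simpl snd.
replace (cos a ^ 2 + sin a ^ 2) with 1; [apply sqrt_1|].
generalize (sin2_cos2 a); unfold Rsqr; lra.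
Qed.

Lemma expi_0 : expi 0 = RtoC 1.
Proof. unfold expi, RtoC; now rewrite cos_0, sin_0. Qed.

Lemma expi_plus a b : expi (a + b) = Cmult (expi a) (expi b).
Proof.
unfold expi, Cmult; simpl; rewrite cos_plus, sin_plus; f_equal; ring.
Qed.

Lemma expi_plus_PI a : expi (a + PI) = Copp (expi a).
Proof. unfold expi, Copp; simpl; now rewrite neg_cos, neg_sin. Qed.

Lemma expi_opp a : expi (- a) = Cinv (expi a).
Proof.
assert (H : Cmult (expi (- a)) (expi a) = RtoC 1).
{ rewrite <- expi_plus, Rplus_opp_l; exact expi_0. }
assert (Ha : expi a <> RtoC 0).
{ intros E; generalize (Cmod_expi a); rewrite E, Cmod_0; lra. }
rewrite <- (Cmult_1_l (Cinv (expi a))), <- H; field; exact Ha.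
Qed.

Lemma Rabs_sin_le a : Rabs (sin a) <= Rabs a.
Proof.
assert (H : forall b, 0 <= b -> Rabs (sin b) <= b).
{ intros b Hb; destruct (Req_dec b 0) as [->|Hne].
    rewrite sin_0, Rabs_R0; lra.
  destruct (Rle_lt_dec b 1) as [H1|H1].
    rewrite Rabs_right; [left; apply sin_lt_x; lra|].
    apply Rle_ge, sin_ge_0; [lra|generalize PI2_1; lra].
  generalize (SIN_bound b); intros; apply Rle_trans with 1; [|lra].
  apply Rabs_le; lra. }
destruct (Rle_lt_dec 0 a) as [Ha|Ha].
  rewrite (Rabs_right a) by lra; now apply H.
rewrite (Rabs_left a) by lra; rewrite <- Rabs_Ropp, <- sin_neg; apply H; lra.
Qed.

(** The squared chord length is [4 sin^2 ((a - b) / 2)]. *)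
Lemma expi_lipschitz a b : Cmod (Cminus (expi a) (expi b)) <= Rabs (a - b).
Proof.
unfold Cmod, expi, Cminus, Cplus, Copp; simpl fst; simpl snd.
rewrite <- sqrt_Rsqr_abs; apply sqrt_le_1_alt.
assert (E : (cos a + - cos b) ^ 2 + (sin a + - sin b) ^ 2 =
  4 * (sin ((a - b) / 2))²).
{ assert (Hd : cos (a - b) = 1 - 2 * (sin ((a - b) / 2))²).
  { replace (a - b) with (2 * ((a - b) / 2)) at 1 by field.
    rewrite cos_2a_sin; unfold Rsqr; ring. }
  rewrite cos_minus in Hd.
  generalize (sin2_cos2 a) (sin2_cos2 b); unfold Rsqr in *; lra. }
rewrite E.
generalize (Rsqr_le_abs_1 _ _ (Rabs_sin_le ((a - b) / 2))); unfold Rsqr; lra.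
Qed.

Lemma unit_circle_expi z : Cmod z = 1 -> exists xi, 0 <= xi <= 1 /\ z = expi (2 * PI * xi).
Proof.
destruct z as [x y]; unfold Cmod; simpl fst; simpl snd; intros H.
assert (H1 : x ^ 2 + y ^ 2 = 1).
{ rewrite <- (sqrt_sqrt (x ^ 2 + y ^ 2)), H; [ring|].
  generalize (pow2_ge_0 x) (pow2_ge_0 y); lra. }
assert (Hx : -1 <= x <= 1) by (generalize (pow2_ge_0 y); intros; split; nra).
assert (Hb := acos_bound x).
assert (HP := PI_RGT_0).
assert (Hs : sin (acos x) = Rabs y).
{ rewrite sin_acos by exact Hx.
  rewrite <- sqrt_Rsqr_abs; f_equal; unfold Rsqr; lra. }
assert (Hdiv : forall a, 0 <= a <= 2 * PI -> 0 <= a / (2 * PI) <= 1).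
{ intros a Ha; split; [apply Rdiv_le_0_compat; lra|].
  apply Rle_div_l; lra. }
destruct (Rle_lt_dec 0 y) as [Hy|Hy].
- exists (acos x / (2 * PI)); split; [apply Hdiv; lra|].
  replace (2 * PI * (acos x / (2 * PI))) with (acos x) by (field; lra).
  unfold expi; rewrite cos_acos, Hs, Rabs_right by lra; easy.
- exists ((2 * PI - acos x) / (2 * PI)); split; [apply Hdiv; lra|].
  replace (2 * PI * ((2 * PI - acos x) / (2 * PI))) with (- acos x + 2 * 1 * PI)
    by (field; lra).
  unfold expi; change 1 with (INR 1); rewrite cos_period, sin_period.
  rewrite cos_neg, sin_neg, cos_acos, Hs, Rabs_left by lra; f_equal; ring.
Qed.

(** * Bounds for resolvents on the unit circle *)

Section ResolventOnTheCircle.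

Context {X : CompleteNormedModule C_AbsRing}.

(** The form [1 - e^{ia} W] rather than [e^{ia} - W]: it is invertible when [e^{-ia}] is in the
    resolvent set, and the product over the angles [a] and [a + PI] is [1 - e^{2ia} W^2]. *)
Definition circle_op (W : X -> X) (a : R) (x : X) : X :=
  minus x (scal (expi a : C_AbsRing) (W x)).

Lemma circle_op_linear W a : is_linear W -> is_linear (circle_op W a).
Proof.
intros HW; apply (is_linear_minus_fun (fun x => x)); [exact is_linear_id|].
now apply is_linear_scal_fun.
Qed.

(** An inverse at one angle gives a lower bound at all nearby angles; compactness of [[0, 2 * PI]]
    makes it uniform. *)
Lemma circle_resolvent_uniform_bound (W : X -> X) :
  is_linear W ->
  (forall a, 0 <= a <= 2 * PI -> invertible (circle_op W a)) ->
  exists M, 0 < M /\ forall a, 0 <= a <= 2 * PI ->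
    forall x, norm x <= M * norm (circle_op W a x).
Proof.
intros HW Hinv.
destruct (is_linear_bounded W HW) as [w [Hw0 Hw]].
(* One number is both the radius of the neighbourhood and, inverted, the constant there, so a common
   lower bound on the radii yields a common constant. *)
assert (Hloc : forall a, exists d : posreal, 0 <= a <= 2 * PI ->
  forall b, Rabs (b - a) < d -> forall x, norm x <= / d * norm (circle_op W b x)).
{ intros a; destruct (classic (0 <= a <= 2 * PI)) as [Ha|Ha];
    [|exists (mkposreal 1 Rlt_0_1); now intros H].
  destruct (Hinv a Ha) as [Q [HQ [HQG _]]].
  destruct (is_linear_bounded Q HQ) as [K [HK0 HK]].
  assert (Hd : 0 < Rmin (/ (2 * K)) (/ (2 * K * w))).
  { apply Rmin_pos; apply Rinv_0_lt_compat; repeat apply Rmult_lt_0_compat; lra. }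
  exists (mkposreal _ Hd); intros _ b Hb x; simpl in *.
  set (d := Rmin (/ (2 * K)) (/ (2 * K * w))) in *.
  assert (Hdist : norm (minus (circle_op W a x) (circle_op W b x)) <=
      Rabs (b - a) * (w * norm x)).
  { replace (minus (circle_op W a x) (circle_op W b x))
      with (scal (Cminus (expi b) (expi a) : C_AbsRing) (W x))
      by (unfold circle_op; vec).
    rewrite norm_scal_C; apply Rmult_le_compat;
      [apply Cmod_ge_0|apply norm_ge_0|apply expi_lipschitz|apply Hw]. }
  assert (H1 := HK (circle_op W a x)); rewrite HQG in H1.
  assert (H2 := norm_le_minus (circle_op W a x) (circle_op W b x)).
  assert (Hx := norm_ge_0 x).
  assert (Hdw : K * (Rabs (b - a) * (w * norm x)) <= / 2 * norm x).
  { replace (K * (Rabs (b - a) * (w * norm x)))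
      with (K * w * Rabs (b - a) * norm x) by ring.
    apply Rmult_le_compat_r; [exact Hx|].
    apply Rle_trans with (K * w * / (2 * K * w)); [|apply Req_le; field; lra].
    apply Rmult_le_compat_l; [apply Rmult_le_pos; lra|].
    apply Rle_trans with (1 := Rlt_le _ _ Hb), Rmin_r. }
  assert (H3 : 2 * K <= / d).
  { rewrite <- (Rinv_inv (2 * K)); apply Rinv_le_contravar; [exact Hd|apply Rmin_l]. }
  assert (Hn := norm_ge_0 (circle_op W b x)).
  apply Rle_trans with (2 * K * norm (circle_op W b x));
    [|now apply Rmult_le_compat_r].
  assert (K * norm (circle_op W a x) <= K * (norm (circle_op W b x) +
    Rabs (b - a) * (w * norm x))) by (apply Rmult_le_compat_l; lra).
  lra. }
destruct (functional_choice _ Hloc) as [delta Hdelta].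
destruct (compactness_value_1d 0 (2 * PI) delta) as [d Hd].
exists (/ d); split; [apply Rinv_0_lt_compat, cond_pos|].
intros a Ha x.
(* The covering statement comes doubly negated. *)
apply NNPP; intros Hno; apply (Hd a Ha); intros [t [Ht [Hat Hdt]]]; apply Hno.
eapply Rle_trans; [apply (Hdelta t Ht a Hat)|].
apply Rmult_le_compat_r; [apply norm_ge_0|].
apply Rinv_le_contravar; [apply cond_pos|exact Hdt].
Qed.

Definition resolvent_family (W : X -> X) (M L : R) (F : R -> X -> X) : Prop :=
  (forall a, 0 <= a <= 2 * PI ->
    inverse_op (circle_op W a) (F a) /\ bounded_by M (F a)) /\
  (forall a b, 0 <= a <= 2 * PI -> 0 <= b <= 2 * PI ->
    bounded_by (L * Rabs (a - b)) (fun x => minus (F a x) (F b x))).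

(** Lipschitz dependence on the angle is the resolvent identity
    [F a - F b = (e^{ia} - e^{ib}) F a W F b]. *)
Lemma resolvent_family_exists (W : X -> X) :
  is_linear W ->
  (forall a, 0 <= a <= 2 * PI -> invertible (circle_op W a)) ->
  exists M L F, 0 < M /\ 0 < L /\ resolvent_family W M L F.
Proof.
intros HW Hinv.
destruct (circle_resolvent_uniform_bound W HW Hinv) as [M [HM0 HM]].
destruct (is_linear_bounded W HW) as [w [Hw0 Hw]].
assert (Hex : forall a, exists Q, 0 <= a <= 2 * PI -> inverse_op (circle_op W a) Q).
{ intros a; destruct (classic (0 <= a <= 2 * PI)) as [Ha|Ha].
    destruct (Hinv a Ha) as [Q HQ]; now exists Q.
  exists (fun x => x); now intros H. }
destruct (functional_choice _ Hex) as [F HF].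
exists M, (M * (w * M)), F.
split; [exact HM0|split; [now repeat apply Rmult_lt_0_compat|]].
assert (HB : forall a, 0 <= a <= 2 * PI -> bounded_by M (F a)).
{ intros a Ha x; destruct (HF a Ha) as [_ [_ E]].
  rewrite <- (E x) at 2; now apply HM. }
split; [intros a Ha; split; [now apply HF|now apply HB]|].
intros a b Ha Hb x.
destruct (HF a Ha) as [HL [E1 _]]; destruct (HF b Hb) as [_ [_ E2]].
replace (minus (F a x) (F b x))
  with (F a (scal (Cminus (expi a) (expi b) : C_AbsRing) (W (F b x)))).
- eapply Rle_trans; [now apply HB|].
  rewrite norm_scal_C.
  apply Rle_trans with (M * (Rabs (a - b) * (w * (M * norm x)))); [|apply Req_le; ring].
  apply Rmult_le_compat_l; [lra|apply Rmult_le_compat].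
  + apply Cmod_ge_0.
  + apply norm_ge_0.
  + apply expi_lipschitz.
  + eapply Rle_trans; [apply Hw|apply Rmult_le_compat_l; [lra|now apply HB]].
- rewrite <- (E1 (F b x)) at 2; rewrite <- (op_minus (F a)) by exact HL.
  f_equal; rewrite <- (E2 x) at 2; unfold circle_op; vec.
Qed.

(* If F(z) = (1 - z W)^-1, then (1 - z^2 W^2)^-1 = (F(z) + F(-z)) / 2; the
   averaging keeps the bound and halves the Lipschitz constant in the angle. *)
Lemma resolvent_family_square (W W2 : X -> X) (M L : R) (F : R -> X -> X) :
  is_linear W -> (forall x, W2 x = W (W x)) -> 0 <= M -> 0 <= L ->
  resolvent_family W M L F ->
  exists F2, resolvent_family W2 M (L / 2) F2.
Proof.
intros HW HW2 HM HL0 [HF HL]; assert (HP := PI_RGT_0).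
(* [a / 2] and [a / 2 + PI] are the angles of the two square roots of [e^{ia}], and both remain in
   [[0, 2 * PI]]. *)
exists (fun a x => scal (RtoC (/ 2) : C_AbsRing)
  (plus (F (a / 2) x) (F (a / 2 + PI) x))).
assert (Hh : forall x : X, norm (scal (RtoC (/ 2) : C_AbsRing) x) = / 2 * norm x).
{ intros x; rewrite norm_scal_C, Cmod_R, Rabs_right; lra. }
split.
- intros a Ha.
  destruct (HF (a / 2)) as [[L1 [E1 G1]] B1]; [lra|].
  destruct (HF (a / 2 + PI)) as [[L2 [E2 G2]] B2]; [lra|].
  assert (K1 : forall x, circle_op W2 a x =
      circle_op W (a / 2) (circle_op W (a / 2 + PI) x)).
  { intros x; unfold circle_op; rewrite (op_minus W), (op_scal W) by exact HW.
    rewrite HW2, expi_plus_PI; replace (expi a) with (expi (a / 2 + a / 2))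
      by (f_equal; field); rewrite expi_plus; vec. }
  assert (K2 : forall x, circle_op W2 a x =
      circle_op W (a / 2 + PI) (circle_op W (a / 2) x)).
  { intros x; unfold circle_op; rewrite (op_minus W), (op_scal W) by exact HW.
    rewrite HW2, expi_plus_PI; replace (expi a) with (expi (a / 2 + a / 2))
      by (f_equal; field); rewrite expi_plus; vec. }
  assert (HW2L : is_linear W2).
  { apply (is_linear_ext (fun x => W (W x))); [now intros x|].
    exact (is_linear_comp _ _ HW HW). }
  assert (Hhalf : forall x : X, x = scal (RtoC (/ 2) : C_AbsRing)
      (plus (circle_op W (a / 2) x) (circle_op W (a / 2 + PI) x))).
  { intros x; unfold circle_op; rewrite expi_plus_PI; vec_reflect;
      cnorm; unfold RtoC, Cmult, Cplus, Copp, Cminus; simpl; f_equal; field. }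
  split; [split; [|split]|].
  + apply is_linear_scal_fun; now apply is_linear_plus_fun.
  + intros x; rewrite K1 at 1; rewrite K2, E1, E2.
    rewrite (Hhalf x) at 3; f_equal; apply plus_comm.
  + intros x; rewrite (op_scal (circle_op W2 a)), (op_plus (circle_op W2 a))
      by now apply circle_op_linear.
    rewrite K2, G1, K1, G2.
    rewrite (Hhalf x) at 3; f_equal; apply plus_comm.
  + intros x; rewrite Hh.
    generalize (norm_plus_le (F (a / 2) x) (F (a / 2 + PI) x)) (B1 x) (B2 x); lra.
- intros a b Ha Hb x.
  replace (minus _ _) with (scal (RtoC (/ 2) : C_AbsRing)
    (plus (minus (F (a / 2) x) (F (b / 2) x) : X)
       (minus (F (a / 2 + PI) x) (F (b / 2 + PI) x) : X) : X)) by vec.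
  rewrite Hh.
  assert (H1 := HL (a / 2) (b / 2) ltac:(lra) ltac:(lra) x).
  assert (H2 := HL (a / 2 + PI) (b / 2 + PI) ltac:(lra) ltac:(lra) x).
  replace (Rabs (a / 2 - b / 2)) with (Rabs (a - b) / 2) in H1.
  2: { replace (a / 2 - b / 2) with ((a - b) * / 2) by field.
       rewrite Rabs_mult, (Rabs_right (/ 2)); lra. }
  replace (Rabs (a / 2 + PI - (b / 2 + PI))) with (Rabs (a - b) / 2) in H2.
  2: { replace (a / 2 + PI - (b / 2 + PI)) with ((a - b) * / 2) by field.
       rewrite Rabs_mult, (Rabs_right (/ 2)); lra. }
  cbv beta in H1, H2.
  generalize (norm_plus_le (minus (F (a / 2) x) (F (b / 2) x))
    (minus (F (a / 2 + PI) x) (F (b / 2 + PI) x))); lra.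
Qed.

End ResolventOnTheCircle.

Lemma inverse_op_comm {X : CompleteNormedModule C_AbsRing} (G Q H : X -> X) :
  inverse_op G Q -> (forall x, H (G x) = G (H x)) -> forall x, H (Q x) = Q (H x).
Proof.
intros [_ [E1 E2]] HG x; rewrite <- (E1 (H (Q x))), <- HG; now rewrite E2.
Qed.

Section HyperbolicSemigroups.

Context {X : CompleteNormedModule C_AbsRing} {T : R -> X -> X}.
Hypothesis HT : C0_semigroup T.

Lemma resolvent_family_dyadic t0 :
  0 <= t0 -> (forall a, 0 <= a <= 2 * PI -> invertible (circle_op (T t0) a)) ->
  exists M L, 0 < L /\ forall k : nat,
    exists F, resolvent_family (T (2 ^ k * t0)) M (L * (/ 2) ^ k) F.
Proof.
intros Ht Hinv.
destruct (resolvent_family_exists (T t0) (semigroup_linear HT t0 Ht) Hinv)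
  as [M [L [F [HM [HL HF]]]]].
exists M, L; split; [exact HL|].
induction k as [|k [Fk IH]].
  exists F; simpl; now rewrite Rmult_1_l, Rmult_1_r.
assert (Hk : 0 <= 2 ^ k * t0) by (apply Rmult_le_pos; [apply pow_le; lra|exact Ht]).
destruct (resolvent_family_square (T (2 ^ k * t0)) (T (2 ^ S k * t0)) M
  (L * (/ 2) ^ k) Fk) as [F2 HF2]; try easy.
- now apply (semigroup_linear HT).
- intros x; rewrite <- (semigroup_plus HT) by easy; f_equal; simpl; ring.
- lra.
- apply Rmult_le_pos; [lra|apply pow_le; lra].
- exists F2; replace (L * (/ 2) ^ S k) with (L * (/ 2) ^ k / 2); [exact HF2|].
  simpl; field.
Qed.

(* With [tau = 2^k t0] and [A = (1 - T(2 tau))^-1], the operator [A T(tau)] is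
   half the difference of [(1 - T tau)^-1] and [(1 + T tau)^-1], hence small.
   The truncated Green function
   [A (sum_{j <= b} T(j t) + sum_{j < b} T(2 tau - b t + j t))], where
   [b t < tau <= (b + 1) t], telescopes against [1 - T t] up to two terms
   containing the factor [A T(tau)]. *)
Lemma hyperbolic_one_minus_invertible t0 t :
  0 < t0 -> 0 < t ->
  (forall a, 0 <= a <= 2 * PI -> invertible (circle_op (T t0) a)) ->
  invertible (fun x => minus x (T t x)).
Proof.
intros Ht0 Ht Hinv.
destruct (resolvent_family_dyadic t0 (Rlt_le _ _ Ht0) Hinv) as [M [L [HL HF]]].
destruct (semigroup_locally_bounded HT t) as [K [HK0 HK]].
(* Each of the two leftover terms will be at most [L * (/ 2) ^ k * PI / 2 * K] times [norm x]; this
   [k] makes their sum at most half of [norm x]. *)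
destruct (half_pow_small (L * PI * K) (/ 2)) as [k Hk]; [lra|].
destruct (HF k) as [F [HFi HFl]].
set (tau := 2 ^ k * t0) in *.
assert (Htau : 0 < tau) by (apply Rmult_lt_0_compat; [apply pow_lt; lra|exact Ht0]).
assert (HP := PI_RGT_0).
(* With this [b], both [(b + 1) t] and [2 tau - b t] lie in [[tau, tau + t]], so the semigroup at
   either time is [T tau] times an operator bounded by [K]. *)
destruct (nfloor1_ex (tau / t)) as [b [Hb1 Hb2]]; [now apply Rdiv_lt_0_compat|].
assert (Hbt : INR b * t < tau <= (INR b + 1) * t).
{ apply Rmult_lt_compat_r with (r := t) in Hb1; [|exact Ht].
  apply Rmult_le_compat_r with (r := t) in Hb2; [|lra].
  unfold Rdiv in Hb1, Hb2; rewrite Rmult_assoc, Rinv_l in Hb1, Hb2; lra. }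
assert (Hb0 : 0 <= INR b * t) by (apply Rmult_le_pos; [apply pos_INR|lra]).
set (W := T tau).
assert (HW : is_linear W) by (apply (semigroup_linear HT); lra).
assert (HTt : is_linear (T t)) by (apply (semigroup_linear HT); lra).
destruct (HFi 0) as [I0 _]; [lra|]; destruct (HFi PI) as [I1 _]; [lra|].
assert (C0 : forall x, circle_op W 0 x = minus x (W x)).
{ intros x; unfold circle_op; rewrite expi_0; vec. }
assert (C1 : forall x, circle_op W PI x = plus x (W x)).
{ intros x; unfold circle_op; replace PI with (0 + PI) at 1 by ring.
  rewrite expi_plus_PI, expi_0; vec. }
assert (HC : forall a H, is_linear H -> (forall x, H (W x) = W (H x)) ->
    forall x, H (circle_op W a x) = circle_op W a (H x)).
{ intros a H HH HHW x; unfold circle_op.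
  now rewrite (op_minus H), (op_scal H), HHW by exact HH. }
set (A := fun x => F 0 (F PI x)).
assert (HA : is_linear A) by exact (is_linear_comp _ _ (proj1 I1) (proj1 I0)).
assert (HAcomm : forall x, T t (A x) = A (T t x)).
{ assert (H : forall x, T t (W x) = W (T t x))
    by (intros x; apply (semigroup_comm HT); lra).
  intros x; unfold A.
  rewrite (inverse_op_comm _ _ (T t) I0) by (now apply HC).
  now rewrite (inverse_op_comm _ _ (T t) I1) by (now apply HC). }
assert (HAinv : forall x, A (minus x (W (W x))) = x).
{ intros x; unfold A.
  replace (minus x (W (W x))) with (circle_op W PI (circle_op W 0 x)).
    rewrite (proj1 (proj2 I1)); apply I0.
  rewrite C1, C0, (op_minus W) by exact HW; vec. }
assert (HAW : forall x, norm (A (W x)) <= L * (/ 2) ^ k * PI * / 2 * norm x).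
{ intros x.
  replace (A (W x)) with (scal (RtoC (/ 2) : C_AbsRing) (minus (F 0 x) (F PI x) : X)).
  - rewrite norm_scal_C, Cmod_R, Rabs_right by lra.
    generalize (HFl 0 PI ltac:(lra) ltac:(lra) x); cbv beta.
    rewrite Rminus_0_l, Rabs_Ropp, Rabs_right by lra; lra.
  - rewrite <- (proj2 (proj2 I1) x) at 1.
    rewrite <- (proj1 (proj2 I0) (F PI x)) at 2.
    rewrite <- (op_minus (F 0)) by apply I0.
    rewrite <- (op_scal (F 0)) by apply I0.
    unfold A; f_equal.
    rewrite <- (inverse_op_comm _ _ W I1) by (now apply HC).
    rewrite C0, C1; vec_reflect.
    all: cnorm; unfold RtoC, Cmult, Cplus, Copp, Cminus; simpl; f_equal; field. }
set (r := 2 * tau - INR b * t).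
assert (Hr : is_linear (T r)) by (apply (semigroup_linear HT); unfold r; lra).
set (P := fun n => @orbit_sum X T t n).
assert (HPl : forall n, is_linear (P n))
  by (intros n; apply (orbit_sum_linear HT); lra).
set (Q := fun x => A (plus (P (S b) x) (T r (P b x)))).
assert (HG : is_linear (fun x => minus x (T t x))).
{ now apply (is_linear_minus_fun (fun x => x)); [exact is_linear_id|]. }
assert (HQ : is_linear Q).
{ apply (is_linear_comp (fun x => plus (P (S b) x) (T r (P b x))) A); [|exact HA].
  apply is_linear_plus_fun; [apply HPl|].
  exact (is_linear_comp _ _ (HPl b) Hr). }
assert (HQT : forall x, Q (T t x) = T t (Q x)).
{ intros x; unfold Q, P; rewrite HAcomm, (op_plus (T t)) by exact HTt.
  rewrite !(orbit_sum_comm HT) by lra.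
  rewrite (semigroup_comm HT r t) by (unfold r; lra); easy. }
(* The sums telescope to [x - T ((b + 1) t) x] and [T r (x - T (b t) x)]; as [r + b t = 2 tau], the
   terms [x] and [T (2 tau) x] cancel against [x - W (W x)]. *)
assert (HGQ : forall x,
    minus (minus (Q x) (T t (Q x))) x = minus (A (T r x)) (A (T ((INR b + 1) * t) x))).
{ intros x.
  rewrite <- (HAinv x) at 3; unfold Q at 1 2.
  rewrite HAcomm, <- !(op_minus A) by exact HA; f_equal.
  rewrite (op_plus (T t)) by exact HTt.
  rewrite (semigroup_comm HT t r) by (unfold r; lra).
  transitivity (minus (plus (minus (P (S b) x) (T t (P (S b) x)) : X)
      (T r (minus (P b x) (T t (P b x))))) (minus x (W (W x)))).
    rewrite (op_minus (T r)) by exact Hr; vec.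
  unfold P; rewrite !(orbit_sum_telescope HT) by lra.
  rewrite (op_minus (T r)) by exact Hr.
  unfold W; rewrite <- !(semigroup_plus HT) by (unfold r; lra).
  rewrite S_INR; replace (r + INR b * t) with (tau + tau) by (unfold r; ring).
  vec. }
assert (Hsmall : forall x, norm (minus (minus (Q x) (T t (Q x))) x) <= / 2 * norm x).
{ intros x; rewrite HGQ.
  assert (Hs : forall s, tau <= s <= tau + t ->
      norm (A (T s x)) <= L * (/ 2) ^ k * PI * / 2 * (K * norm x)).
  { intros s Hs; replace s with (tau + (s - tau)) by ring.
    rewrite (semigroup_plus HT) by lra.
    eapply Rle_trans; [apply HAW|].
    apply Rmult_le_compat_l; [|apply HK; lra].
    apply Rmult_le_pos; [|lra]; apply Rmult_le_pos; [|lra].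
    apply Rmult_le_pos; [lra|apply pow_le; lra]. }
  generalize (norm_minus_le (A (T r x)) (A (T ((INR b + 1) * t) x))).
  generalize (Hs r ltac:(unfold r; lra)) (Hs ((INR b + 1) * t) ltac:(lra)).
  apply Rlt_le, Rmult_le_compat_r with (r := norm x) in Hk; [lra|apply norm_ge_0]. }
apply approximate_inverse_invertible with Q; [exact HG|exact HQ| |exact Hsmall].
(* [Q] commutes with [T t], so the estimate on the other side is the same one. *)
intros x; rewrite (op_minus Q), HQT by exact HQ; apply Hsmall.
Qed.

End HyperbolicSemigroups.

(** * Rotation of a semigroup *)

Lemma expi_derivative_0 a eps :
  0 < eps -> exists d, 0 < d /\ forall h, 0 < h < d ->
    Cmod (Cminus (Cmult (RtoC (/ h)) (Cminus (expi (a * h)) (RtoC 1)))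
      (Cmult Ci (RtoC a))) < eps.
Proof.
intros He.
assert (Hc : derivable_pt_lim (fun h => cos (a * h)) 0 0).
{ apply is_derive_Reals; auto_derive; [easy|]; rewrite Rmult_0_r, sin_0; ring. }
assert (Hs : derivable_pt_lim (fun h => sin (a * h)) 0 a).
{ apply is_derive_Reals; auto_derive; [easy|]; rewrite Rmult_0_r, cos_0; ring. }
destruct (Hc (eps / 2)) as [d1 Hd1]; [lra|].
destruct (Hs (eps / 2)) as [d2 Hd2]; [lra|].
exists (Rmin d1 d2); split; [apply Rmin_pos; apply cond_pos|].
intros h [Hh0 Hh].
assert (Hh1 := Rlt_le_trans _ _ _ Hh (Rmin_l d1 d2)).
assert (Hh2 := Rlt_le_trans _ _ _ Hh (Rmin_r d1 d2)).
specialize (Hd1 h ltac:(lra)); rewrite (Rabs_right h) in Hd1 by lra.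
specialize (Hd2 h ltac:(lra)); rewrite (Rabs_right h) in Hd2 by lra.
specialize (Hd1 Hh1); specialize (Hd2 Hh2).
rewrite Rplus_0_l, Rmult_0_r, cos_0 in Hd1.
rewrite Rplus_0_l, Rmult_0_r, sin_0 in Hd2.
match goal with |- Cmod ?z < _ => set (w := z) end.
assert (E1 : fst w = (cos (a * h) - 1) / h - 0).
{ unfold w, expi, Cminus, Cmult, Cplus, Copp, RtoC, Ci; simpl; field; lra. }
assert (E2 : snd w = (sin (a * h) - 0) / h - a).
{ unfold w, expi, Cminus, Cmult, Cplus, Copp, RtoC, Ci; simpl; field; lra. }
rewrite <- E1 in Hd1; rewrite <- E2 in Hd2; clearbody w.
assert (H2 : sqrt 2 <= 2).
{ rewrite <- (sqrt_square 2) at 2 by lra; apply sqrt_le_1_alt; lra. }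
apply Rle_lt_trans with (1 := Cmod_2Rmax w).
apply Rle_lt_trans with (2 * Rmax (Rabs (fst w)) (Rabs (snd w))).
  apply Rmult_le_compat_r; [|exact H2].
  apply Rle_trans with (2 := Rmax_l _ _), Rabs_pos.
assert (Rmax (Rabs (fst w)) (Rabs (snd w)) < eps / 2) by now apply Rmax_lub_lt.
lra.
Qed.

Section Rotation.

Context {X : CompleteNormedModule C_AbsRing}.

Lemma invertible_ext (G H : X -> X) :
  (forall x, G x = H x) -> invertible G -> invertible H.
Proof.
intros E [Q [HQ [E1 E2]]]; exists Q; split; [exact HQ|].
split; intros x; rewrite <- E; [apply E1|apply E2].
Qed.

Lemma invertible_scal (c : Complex.C) (G : X -> X) :
  c <> RtoC 0 -> is_linear G -> invertible G ->
  invertible (fun x => scal (c : C_AbsRing) (G x)).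
Proof.
intros Hc HG [Q [HQ [E1 E2]]].
assert (E : forall x : X,
    scal (Cinv c : C_AbsRing) (scal (c : C_AbsRing) x : X) = x).
{ intros x; vec_reflect; cnorm; field; exact Hc. }
exists (fun x => scal (Cinv c : C_AbsRing) (Q x)).
split; [now apply is_linear_scal_fun|split; intros x].
  rewrite (op_scal Q), E1 by exact HQ; apply E.
rewrite (op_scal G), E2 by exact HG.
vec_reflect; cnorm; field; exact Hc.
Qed.

Lemma expi_neq_0 a : expi a <> RtoC 0.
Proof. intros E; generalize (Cmod_expi a); rewrite E, Cmod_0; lra. Qed.

Lemma resolvent_set_rotate (W V : X -> X) (a b : R) :
  is_linear W -> (forall x, V x = scal (expi b : C_AbsRing) (W x)) ->
  resolvent_set W (expi a) -> resolvent_set V (expi (b + a)).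
Proof.
intros HW HV HR; apply resolvent_set_invertible; apply resolvent_set_invertible in HR.
apply (invertible_scal (expi b)) in HR; [|apply expi_neq_0|].
- revert HR; apply invertible_ext; intros x; rewrite HV, expi_plus; vec.
- apply (is_linear_minus_fun (scal (expi a : C_AbsRing))); [|exact HW].
  exact (is_linear_scal_fun (expi a) (fun x => x) is_linear_id).
Qed.

Lemma circle_op_invertible (W : X -> X) (a : R) :
  is_linear W -> resolvent_set W (expi (- a)) -> invertible (circle_op W a).
Proof.
intros HW HR.
apply (resolvent_set_rotate W (fun x => scal (expi a : C_AbsRing) (W x)) _ a) in HR;
  try easy.
rewrite Rplus_opp_r, expi_0 in HR; apply resolvent_set_invertible in HR.
revert HR; apply invertible_ext; intros x; unfold circle_op; vec.
Qed.

(** Its generator is that of [T] plus [i a]. *)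
Definition rotated (a : R) (T : R -> X -> X) (t : R) (x : X) : X :=
  scal (expi (a * t) : C_AbsRing) (T t x).

Lemma rotated_opp a T t x : rotated (- a) (rotated a T) t x = T t x.
Proof.
unfold rotated.
replace (- a * t) with (- (a * t)) by ring; rewrite expi_opp.
vec_reflect; cnorm; field; apply expi_neq_0.
Qed.

Lemma norm_scal_expi a (x : X) : norm (scal (expi a : C_AbsRing) x) = norm x.
Proof. rewrite norm_scal_C, Cmod_expi; ring. Qed.

Lemma rotated_C0_semigroup a T : C0_semigroup T -> C0_semigroup (rotated a T).
Proof.
intros HT; split; [|split; [|split]].
- intros t Ht; apply is_linear_scal_fun; now apply (semigroup_linear HT).
- intros x; unfold rotated; rewrite Rmult_0_r, expi_0, (semigroup_0 HT); vec.
- intros s t x Hs Ht; unfold rotated.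
  rewrite (semigroup_plus HT), (op_scal (T s)) by (try apply (semigroup_linear HT); easy).
  rewrite Rmult_plus_distr_l, expi_plus; vec.
- intros x; apply filterlim_at_right_0; intros eps He.
  destruct (semigroup_right_continuous HT x (eps / 2)) as [d [Hd Hx]]; [lra|].
  set (c := Rabs a * norm x + 1).
  assert (Hc : 0 < c).
  { assert (0 <= Rabs a * norm x)
      by (apply Rmult_le_pos; [apply Rabs_pos|apply norm_ge_0]).
    unfold c; lra. }
  exists (Rmin d (eps / 2 / c)); split.
    apply Rmin_pos; [exact Hd|apply Rdiv_lt_0_compat; lra].
  intros h [Hh0 Hh].
  assert (Hh1 := Rlt_le_trans _ _ _ Hh (Rmin_l _ _)).
  assert (Hh2 := Rlt_le_trans _ _ _ Hh (Rmin_r _ _)).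
  specialize (Hx h ltac:(lra)).
  replace (minus (rotated a T h x) x)
    with (plus (scal (expi (a * h) : C_AbsRing) (minus (T h x) x) : X)
      (scal (Cminus (expi (a * h)) (expi 0) : C_AbsRing) x))
    by (unfold rotated; rewrite expi_0; vec).
  eapply Rle_lt_trans; [apply norm_plus_le|].
  rewrite norm_scal_expi, norm_scal_C.
  assert (H1 : Cmod (Cminus (expi (a * h)) (expi 0)) * norm x <= h * c).
  { apply Rle_trans with (Rabs a * h * norm x).
      apply Rmult_le_compat_r; [apply norm_ge_0|].
      eapply Rle_trans; [apply expi_lipschitz|].
      rewrite Rminus_0_r, Rabs_mult, (Rabs_right h); lra.
    unfold c; lra. }
  assert (H2 : h * c < eps / 2).
  { apply Rmult_lt_compat_r with (r := c) in Hh2; [|exact Hc].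
    unfold Rdiv in Hh2; rewrite (Rmult_assoc _ (/ c)), Rinv_l in Hh2; lra. }
  lra.
Qed.

Lemma generator_limit_iff (T : R -> X -> X) x y :
  generator_limit T x y <-> forall eps, 0 < eps -> exists d, 0 < d /\
    forall h, 0 < h < d ->
      norm (minus (scal (RtoC (/ h) : C_AbsRing) (minus (T h x) x)) y) < eps.
Proof. exact (filterlim_at_right_0 _ y). Qed.

Lemma generator_limit_ext (T S : R -> X -> X) x y :
  (forall t z, T t z = S t z) -> generator_limit T x y -> generator_limit S x y.
Proof.
intros E; apply filterlim_ext; intros h; now rewrite E.
Qed.

Lemma rotated_generator_limit a (T : R -> X -> X) x y :
  generator_limit T x y ->
  generator_limit (rotated a T) x
    (plus y (scal (Cmult Ci (RtoC a) : C_AbsRing) x)).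
Proof.
intros HT; apply generator_limit_iff; intros eps He.
destruct (proj1 (generator_limit_iff T x y) HT (eps / 3)) as [d1 [Hd1 H1]]; [lra|].
assert (Hx := norm_ge_0 x); assert (Hy := norm_ge_0 y).
destruct (expi_derivative_0 a (eps / 3 / (norm x + 1))) as [d2 [Hd2 H2]].
  apply Rdiv_lt_0_compat; lra.
set (c := Rabs a * norm y + 1).
assert (Hc : 0 < c).
{ assert (0 <= Rabs a * norm y) by (apply Rmult_le_pos; [apply Rabs_pos|exact Hy]).
  unfold c; lra. }
assert (Hd3 : 0 < eps / 3 / c) by (apply Rdiv_lt_0_compat; lra).
exists (Rmin d1 (Rmin d2 (eps / 3 / c))); split.
  repeat apply Rmin_pos; easy.
intros h [Hh0 Hh].
assert (Hh1 := Rlt_le_trans _ _ _ Hh (Rmin_l _ _)).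
assert (Hh' := Rlt_le_trans _ _ _ Hh (Rmin_r _ _)).
assert (Hh2 := Rlt_le_trans _ _ _ Hh' (Rmin_l _ _)).
assert (Hh3 := Rlt_le_trans _ _ _ Hh' (Rmin_r _ _)).
specialize (H1 h ltac:(lra)); specialize (H2 h ltac:(lra)).
match type of H2 with Cmod ?z < _ => set (w := z) in H2 end.
(* Product rule: [e^{iah}] times the error of the difference quotient of [T], plus
   [(e^{iah} - 1) y], plus the error [w x] of the quotient of [e^{iah}]; each is at most [eps / 3]
   in norm. *)
match goal with |- norm ?z < _ => replace z with
  (plus (plus (scal (expi (a * h) : C_AbsRing)
       (minus (scal (RtoC (/ h) : C_AbsRing) (minus (T h x) x)) y) : X)
     (scal (Cminus (expi (a * h)) (expi 0) : C_AbsRing) y) : X)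
   (scal (w : C_AbsRing) x) : X) by (unfold w, rotated; rewrite expi_0; vec) end.
eapply Rle_lt_trans; [apply norm_plus_le|].
eapply Rle_lt_trans; [apply Rplus_le_compat_r, norm_plus_le|].
rewrite norm_scal_expi, !norm_scal_C.
assert (B1 : Cmod (Cminus (expi (a * h)) (expi 0)) * norm y <= h * c).
{ apply Rle_trans with (Rabs a * h * norm y).
    apply Rmult_le_compat_r; [exact Hy|].
    eapply Rle_trans; [apply expi_lipschitz|].
    rewrite Rminus_0_r, Rabs_mult, (Rabs_right h); lra.
  unfold c; lra. }
assert (B2 : h * c < eps / 3).
{ apply Rmult_lt_compat_r with (r := c) in Hh3; [|exact Hc].
  unfold Rdiv in Hh3; rewrite (Rmult_assoc _ (/ c)), Rinv_l in Hh3; lra. }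
assert (B3 : Cmod w * norm x <= eps / 3).
{ apply Rle_trans with (eps / 3 / (norm x + 1) * (norm x + 1)).
    apply Rmult_le_compat; [apply Cmod_ge_0|exact Hx|lra|lra].
  apply Req_le; field; lra. }
lra.
Qed.

Lemma rotated_generates a (A1 A2 : unbounded_op X) (T : R -> X -> X) :
  (forall x, dom A2 x <-> dom A1 x) ->
  (forall x, op A2 x = plus (op A1 x) (scal (Cmult Ci (RtoC a) : C_AbsRing) x)) ->
  generates A1 T -> generates A2 (rotated a T).
Proof.
intros Hdom Hop [HT [HA1 HA2]]; split; [now apply rotated_C0_semigroup|].
split.
- intros x; rewrite Hdom, HA1; split; intros [y Hy].
    eexists; apply rotated_generator_limit; exact Hy.
  (* Rotating back by [- a] recovers [T], which gives the reverse inclusion of domains. *)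
  eexists; apply (generator_limit_ext (rotated (- a) (rotated a T))).
    apply rotated_opp.
  apply rotated_generator_limit; exact Hy.
- intros x Hx; rewrite Hop; apply rotated_generator_limit, HA2; now apply Hdom.
Qed.

(** Rotation by [b = - a / t] moves [e^{ia}] to 1 at time [t] and maps the circle to itself at time
    [t0], so it suffices to invert [1 - rotated b T t]. *)
Lemma hyperbolic_resolvent_set (T : R -> X -> X) t a :
  C0_semigroup T -> hyperbolic T -> 0 < t -> resolvent_set (T t) (expi a).
Proof.
intros HT [t0 [Ht0 Hsp]] Ht.
set (b := - a / t).
assert (HS := rotated_C0_semigroup b T HT).
assert (H1 : resolvent_set (rotated b T t) (expi 0)).
{ apply resolvent_set_invertible.
  apply (invertible_ext (fun x => minus x (rotated b T t x))).
    intros x; rewrite expi_0; vec.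
  apply (hyperbolic_one_minus_invertible HS t0 t); [exact Ht0|exact Ht|].
  intros c _; apply circle_op_invertible; [apply (semigroup_linear HS); lra|].
  replace (- c) with (b * t0 + (- c - b * t0)) by ring.
  apply resolvent_set_rotate with (T t0); [apply (semigroup_linear HT); lra|easy|].
  apply NNPP; intros Hn; apply (Hsp (expi (- c - b * t0))); split; [exact Hn|].
  apply Cmod_expi. }
replace a with (- (b * t) + 0) by (unfold b; field; lra).
revert H1; apply resolvent_set_rotate; [apply (semigroup_linear HS); lra|].
intros x; rewrite <- (rotated_opp b T) at 1; unfold rotated at 1.
now replace (- b * t) with (- (b * t)) by ring.
Qed.

End Rotation.

(** * Density of the domain of the generator *)

(* Coquelicot integrates functions with values in real normed modules only. *)
Section RestrictionOfScalars.

Variable X : CompleteNormedModule C_AbsRing.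

Definition real_scal (a : R) (x : X) : X := scal (RtoC a : C_AbsRing) x.

Lemma real_scal_assoc a b x : real_scal a (real_scal b x) = real_scal (a * b) x.
Proof. unfold real_scal; rewrite RtoC_mult; vec. Qed.

Lemma real_scal_one x : real_scal 1 x = x.
Proof. unfold real_scal; vec. Qed.

Lemma real_scal_distr_l a x y :
  real_scal a (plus x y) = plus (real_scal a x) (real_scal a y).
Proof. unfold real_scal; vec. Qed.

Lemma real_scal_distr_r a b x :
  real_scal (a + b) x = plus (real_scal a x) (real_scal b x).
Proof. unfold real_scal; rewrite RtoC_plus; vec. Qed.

Lemma real_scal_norm a x : norm (real_scal a x) <= Rabs a * norm x.
Proof. unfold real_scal; rewrite norm_scal_C, Cmod_R; lra. Qed.

Definition real_module_mixin :
    ModuleSpace.mixin_of R_Ring (CompleteNormedModule.AbelianGroup C_AbsRing X) :=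
  ModuleSpace.Mixin R_Ring (CompleteNormedModule.AbelianGroup C_AbsRing X)
    real_scal real_scal_assoc real_scal_one real_scal_distr_l real_scal_distr_r.

Definition real_module_aux : NormedModuleAux R_AbsRing :=
  NormedModuleAux.Pack R_AbsRing X
    (NormedModuleAux.Class R_AbsRing X
      (ModuleSpace.Class R_AbsRing X _ real_module_mixin)
      (UniformSpace.class (CompleteNormedModule.UniformSpace C_AbsRing X))) X.

Definition real_normed_mixin : NormedModule.mixin_of R_AbsRing real_module_aux :=
  NormedModule.Mixin R_AbsRing real_module_aux (fun x : X => norm x)
    (@norm_factor C_AbsRing X) norm_triangle real_scal_norm
    norm_compat1 norm_compat2 norm_eq_zero.

Definition realification : CompleteNormedModule R_AbsRing :=
  CompleteNormedModule.Pack R_AbsRing X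
    (CompleteNormedModule.Class R_AbsRing X
      (NormedModule.Class R_AbsRing X _ real_normed_mixin)
      (CompleteNormedModule.mixin C_AbsRing X (CompleteNormedModule.class C_AbsRing X))) X.

End RestrictionOfScalars.

Lemma Riemann_sum_linear {U V : NormedModule R_AbsRing} (l : U -> V) (f : R -> U)
    (ptd : SF_seq) :
  is_linear l -> Riemann_sum (fun s => l (f s)) ptd = l (Riemann_sum f ptd).
Proof.
intros Hl; induction ptd as [x0|h s IH] using SF_cons_ind.
  symmetry; exact (linear_zero l Hl).
rewrite !Riemann_sum_cons, IH, (linear_plus l Hl); f_equal.
symmetry; exact (linear_scal l Hl _ _).
Qed.

Lemma is_RInt_linear {U V : NormedModule R_AbsRing} (l : U -> V) (f : R -> U)
    (a b : R) (If : U) :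
  is_linear l -> is_RInt f a b If -> is_RInt (fun s => l (f s)) a b (l If).
Proof.
intros Hl Hf.
apply filterlim_ext with
  (fun ptd => l (scal (sign (b - a)) (Riemann_sum f ptd))).
  intros ptd; rewrite (Riemann_sum_linear l) by exact Hl.
  exact (linear_scal l Hl _ _).
eapply filterlim_comp; [exact Hf|exact (linear_cont l If Hl)].
Qed.

(** * Integrals of vector-valued functions *)

Section Integral.

Context {X : CompleteNormedModule C_AbsRing}.

Definition vint (f : R -> X) (a b : R) : X := RInt (V := realification X) f a b.

Lemma vint_correct (f : R -> X) a b :
  (forall s, continuous f s) -> is_RInt (V := realification X) f a b (vint f a b).
Proof.
intros Hf; apply (RInt_correct (V := realification X)).
apply (ex_RInt_continuous (V := realification X)); intros z _; exact (Hf z).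
Qed.

Lemma vint_Chasles (f : R -> X) a b c :
  (forall s, continuous f s) -> plus (vint f a b) (vint f b c) = vint f a c.
Proof.
intros Hf; symmetry; apply (is_RInt_unique (V := realification X)).
apply (is_RInt_Chasles (V := realification X) f a b c); now apply vint_correct.
Qed.

(** A bounded operator passes under the integral, and a translation of the variable follows. The
    relation is asked only between the endpoints: for a reflected orbit [T (Rabs u) x] it is
    available only at nonnegative times. *)
Lemma vint_shift (L : X -> X) (f : R -> X) a b h :
  is_linear L -> (forall s, continuous f s) ->
  (forall s, Rmin a b < s < Rmax a b -> L (f s) = f (s + h)) ->
  L (vint f a b) = vint f (a + h) (b + h).
Proof.
intros HL Hf HLf.
assert (HLR : is_linear (U := realification X) (V := realification X) L).
{ apply Build_is_linear; [exact (linear_plus L HL)| |exact (linear_norm L HL)].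
  intros k x; exact (linear_scal L HL (RtoC k) x). }
transitivity (RInt (V := realification X) (fun s => L (f s)) a b).
  symmetry; apply (is_RInt_unique (V := realification X)).
  apply (is_RInt_linear (U := realification X) (V := realification X)); [exact HLR|].
  now apply vint_correct.
apply (is_RInt_unique (V := realification X)).
apply (is_RInt_ext (V := realification X)
  (fun s => scal (V := realification X) 1 (f (1 * s + h)))).
  intros s Hs; rewrite (scal_one (V := realification X)), Rmult_1_l; symmetry; now apply HLf.
apply (is_RInt_comp_lin (V := realification X)); rewrite !Rmult_1_l.
now apply vint_correct.
Qed.

(** The fundamental theorem of calculus at the left endpoint, written without division by [h]. *)
Lemma vint_near (f : R -> X) a eps :
  (forall s, continuous f s) -> 0 < eps ->
  exists d, 0 < d /\ forall h, 0 < h < d ->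
    norm (minus (vint f a (a + h)) (scal (RtoC h : C_AbsRing) (f a))) <= h * eps.
Proof.
intros Hf He.
destruct (proj1 (filterlim_norm_iff f (f a)) (Hf a) eps He) as [d Hd].
exists d; split; [apply cond_pos|]; intros h Hh.
replace (h * eps) with ((a + h - a) * eps) by ring.
replace h with (a + h - a) at 2 by ring.
apply (norm_RInt_le_const (V := realification X) (fun s => minus (f s) (f a) : X) a (a + h)).
- lra.
- intros s Hs; left; apply Hd.
  apply (norm_compat1 a s); unfold norm, minus, plus, opp; simpl; unfold abs; simpl.
  rewrite Rabs_right; lra.
- apply (is_RInt_minus (V := realification X) f (fun _ => f a)).
    now apply vint_correct.
  apply (is_RInt_const (V := realification X)).
Qed.

End Integral.

Section Density.

Context {X : CompleteNormedModule C_AbsRing} {T : R -> X -> X}.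
Hypothesis HT : C0_semigroup T.

Lemma semigroup_orbit_lipschitz t K x s u :
  (forall v, 0 <= v <= t -> bounded_by K (T v)) -> 0 <= s <= t -> 0 <= u ->
  norm (minus (T (s + u) x) (T s x)) <= K * norm (minus (T u x) x).
Proof.
intros HK Hs Hu; rewrite (semigroup_plus HT) by lra.
rewrite <- (op_minus (T s)) by (apply (semigroup_linear HT); lra).
now apply HK.
Qed.

(* Reflecting the orbit at 0 makes it continuous on the whole line, as
   [vint] requires; [T] is arbitrary at negative times. *)
Lemma semigroup_orbit_continuous x s : continuous (fun u => T (Rabs u) x) s.
Proof.
apply filterlim_norm_iff; intros eps He.
destruct (semigroup_locally_bounded HT (Rabs s + 1)) as [K [HK0 HK]].
destruct (semigroup_right_continuous HT x (eps / K)) as [d [Hd Hx]].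
  now apply Rdiv_lt_0_compat.
(* The cap 1 keeps [Rabs u] below [Rabs s + 1], where [K] is valid. *)
assert (Hd1 : 0 < Rmin d 1) by (apply Rmin_pos; lra).
exists (mkposreal _ Hd1); intros u Hu.
change (Rabs (u + - s) < Rmin d 1) in Hu.
assert (Hu1 := Rlt_le_trans _ _ _ Hu (Rmin_l _ _)).
assert (Hu2 := Rlt_le_trans _ _ _ Hu (Rmin_r _ _)).
assert (Hdist := Rabs_triang_inv2 u s); unfold Rminus in Hdist.
assert (Hs0 := Rabs_pos s); assert (Hu0 := Rabs_pos u).
assert (Hmain : forall v w, 0 <= v -> v <= w -> w <= Rabs s + 1 ->
    w - v < d -> norm (minus (T w x) (T v x)) < eps).
{ intros v w Hv Hvw Hw Hlt.
  destruct (Req_dec v w) as [->|Hne]; [rewrite norm_minus_self; lra|].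
  replace w with (v + (w - v)) by ring.
  eapply Rle_lt_trans.
    apply (semigroup_orbit_lipschitz (Rabs s + 1) K); [exact HK|lra|lra].
  specialize (Hx (w - v) ltac:(lra)).
  apply Rmult_lt_compat_l with (r := K) in Hx; [|exact HK0].
  replace (K * (eps / K)) with eps in Hx by (field; lra); exact Hx. }
destruct (Rle_lt_dec (Rabs s) (Rabs u)) as [Hle|Hlt].
  rewrite (Rabs_right (Rabs u + - Rabs s)) in Hdist by lra.
  apply Hmain; lra.
rewrite (Rabs_left (Rabs u + - Rabs s)) in Hdist by lra.
rewrite norm_minus_sym; apply Hmain; lra.
Qed.

Lemma generator_limit_scal c x y :
  generator_limit T x y ->
  generator_limit T (scal (c : C_AbsRing) x) (scal (c : C_AbsRing) y).
Proof.
intros Hxy; apply generator_limit_iff; intros eps He.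
assert (Hc := Cmod_ge_0 c).
destruct (proj1 (generator_limit_iff T x y) Hxy (eps / (Cmod c + 1))) as [d [Hd H]].
  apply Rdiv_lt_0_compat; lra.
exists d; split; [exact Hd|]; intros h Hh; specialize (H h Hh).
rewrite (op_scal (T h)) by (apply (semigroup_linear HT); lra).
set (z := minus (scal (RtoC (/ h) : C_AbsRing) (minus (T h x) x)) y) in H.
match goal with |- norm ?w < _ =>
  replace w with (scal (c : C_AbsRing) (z : X)) by (unfold z; vec) end.
rewrite norm_scal_C.
apply Rmult_lt_compat_l with (r := Cmod c + 1) in H; [|lra].
replace ((Cmod c + 1) * (eps / (Cmod c + 1))) with eps in H by (field; lra).
generalize (norm_ge_0 (z : X)); lra.
Qed.

(** [T h - 1] applied to the integral over [[0, t]] is the integral over [[t, t + h]] minus that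
    over [[0, h]]; divided by [h] these tend to [T t x] and [x]. *)
Lemma generator_limit_integral x t :
  0 < t ->
  generator_limit T (vint (fun u => T (Rabs u) x) 0 t) (minus (T t x) x).
Proof.
intros Ht; apply generator_limit_iff; intros eps He.
set (f := fun u => T (Rabs u) x).
assert (Hf : forall s, continuous f s) by exact (semigroup_orbit_continuous x).
destruct (vint_near f t (eps / 3) Hf) as [d1 [Hd1 H1]]; [lra|].
destruct (vint_near f 0 (eps / 3) Hf) as [d2 [Hd2 H2]]; [lra|].
exists (Rmin d1 d2); split; [now apply Rmin_pos|]; intros h [Hh0 Hh].
specialize (H1 h (conj Hh0 (Rlt_le_trans _ _ _ Hh (Rmin_l _ _)))).
specialize (H2 h (conj Hh0 (Rlt_le_trans _ _ _ Hh (Rmin_r _ _)))).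
rewrite (vint_shift (T h) f 0 t h).
2: apply (semigroup_linear HT); lra.
2: exact Hf.
2: { intros s Hs; rewrite Rmin_left, Rmax_right in Hs by lra; unfold f.
     rewrite <- (semigroup_plus HT) by (try apply Rabs_pos; lra).
     rewrite !Rabs_right by lra; f_equal; ring. }
assert (E1 := vint_Chasles f 0 h (t + h) Hf).
assert (E2 := vint_Chasles f 0 t (t + h) Hf).
rewrite !Rplus_0_l in *.
set (a := minus (vint f t (t + h)) (scal (RtoC h : C_AbsRing) (f t)) : X) in H1.
set (b := minus (vint f 0 h) (scal (RtoC h : C_AbsRing) (f 0)) : X) in H2.
assert (Hft : f t = T t x) by (unfold f; now rewrite Rabs_right by lra).
assert (Hf0 : f 0 = x) by (unfold f; now rewrite Rabs_R0, (semigroup_0 HT)).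
assert (E : minus (vint f h (t + h)) (vint f 0 t) =
    plus (minus a b) (scal (RtoC h : C_AbsRing) (minus (f t) (f 0)))).
{ transitivity (minus (minus (plus (vint f 0 h) (vint f h (t + h)) : X) (vint f 0 h) : X)
    (vint f 0 t)); [vec|].
  rewrite E1, <- E2; unfold a, b; vec. }
rewrite E, <- Hft, <- Hf0.
match goal with |- norm ?w < _ =>
  replace w with (scal (RtoC (/ h) : C_AbsRing) (minus a b : X)) end.
- rewrite norm_scal_C, Cmod_R, Rabs_right.
  2: apply Rle_ge, Rlt_le, Rinv_0_lt_compat, Hh0.
  apply Rle_lt_trans with (/ h * (h * (2 * (eps / 3)))).
    apply Rmult_le_compat_l; [apply Rlt_le, Rinv_0_lt_compat, Hh0|].
    generalize (norm_minus_le a b); lra.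
  rewrite <- Rmult_assoc, Rinv_l; lra.
- assert (Hh1 : RtoC h <> RtoC 0) by (intros E0; apply RtoC_inj in E0; lra).
  rewrite RtoC_inv by lra; vec_reflect; cnorm; field; exact Hh1.
Qed.

(** The averages of the orbit over [[0, h]] lie in the domain and tend to [x]. *)
Lemma generator_domain_dense x eps :
  0 < eps -> exists y, (exists z, generator_limit T y z) /\ norm (minus y x) <= eps.
Proof.
intros He.
set (f := fun u => T (Rabs u) x).
assert (Hf : forall s, continuous f s) by exact (semigroup_orbit_continuous x).
destruct (vint_near f 0 eps Hf He) as [d [Hd H]].
set (h := d / 2); specialize (H h ltac:(unfold h; lra)).
assert (Hh : 0 < h) by (unfold h; lra).
assert (Hf0 : f 0 = x) by (unfold f; now rewrite Rabs_R0, (semigroup_0 HT)).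
rewrite Rplus_0_l, Hf0 in H.
exists (scal (RtoC (/ h) : C_AbsRing) (vint f 0 h)); split.
  eexists; now apply generator_limit_scal, generator_limit_integral.
set (a := minus (vint f 0 h) (scal (RtoC h : C_AbsRing) x) : X) in H.
match goal with |- norm ?w <= _ =>
  replace w with (scal (RtoC (/ h) : C_AbsRing) a) end.
- rewrite norm_scal_C, Cmod_R, Rabs_right.
  2: apply Rle_ge, Rlt_le, Rinv_0_lt_compat, Hh.
  apply Rmult_le_reg_l with h; [exact Hh|].
  rewrite <- Rmult_assoc, Rinv_r; lra.
- assert (Hh1 : RtoC h <> RtoC 0) by (intros E0; apply RtoC_inj in E0; lra).
  unfold a; rewrite RtoC_inv by lra; vec_reflect; cnorm; field; exact Hh1.
Qed.

End Density.

(** * Bounded perturbations of the generator *)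

(** A supremum argument: the bound with slope [c + eps] reaches the supremum by left continuity and
    passes beyond it by the estimate to the right, so one-sided derivatives are enough. *)
Lemma mean_value_right {X : CompleteNormedModule C_AbsRing} (phi : R -> X) (t c : R) :
  0 <= t -> 0 <= c ->
  (forall s eps, 0 <= s < t -> 0 < eps -> exists d, 0 < d /\ forall h, 0 < h < d ->
    s + h <= t -> norm (minus (phi (s + h)) (phi s)) <= (c + eps) * h) ->
  (forall s eps, 0 < s <= t -> 0 < eps -> exists d, 0 < d /\ forall h, 0 < h < d ->
    0 <= s - h -> norm (minus (phi s) (phi (s - h))) <= eps) ->
  norm (minus (phi t) (phi 0)) <= c * t.
Proof.
intros Ht Hc Hright Hleft.
assert (Hmain : forall eps, 0 < eps -> norm (minus (phi t) (phi 0)) <= (c + eps) * t).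
{ intros eps He.
  set (E := fun s => 0 <= s <= t /\
    forall u, 0 <= u <= s -> norm (minus (phi u) (phi 0)) <= (c + eps) * u).
  assert (E0 : E 0).
  { split; [lra|]; intros u Hu; replace u with 0 by lra.
    rewrite norm_minus_self; lra. }
  destruct (completeness E) as [m [Hub Hlub]].
    exists t; intros s Hs; apply Hs.
    now exists 0.
  assert (Hm0 : 0 <= m) by now apply Hub.
  assert (Hmt : m <= t) by (apply Hlub; intros s Hs; apply Hs).
  assert (Hlt : forall u, 0 <= u < m -> norm (minus (phi u) (phi 0)) <= (c + eps) * u).
  { intros u Hu; apply NNPP; intros Hn.
    assert (m <= u); [|lra].
    apply Hlub; intros s Hs; apply Rnot_lt_le; intros Hus.
    apply Hn, Hs; lra. }
  assert (Hm : norm (minus (phi m) (phi 0)) <= (c + eps) * m).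
  { destruct (Req_dec m 0) as [->|Hne]; [rewrite norm_minus_self; lra|].
    apply le_epsilon; intros e He'.
    destruct (Hleft m e ltac:(lra) He') as [d [Hd H]].
    set (h := Rmin d m / 2).
    assert (Hh : 0 < h /\ h < d /\ h < m).
    { assert (0 < Rmin d m) by (apply Rmin_pos; lra).
      generalize (Rmin_l d m) (Rmin_r d m); unfold h; lra. }
    specialize (H h ltac:(lra) ltac:(lra)).
    specialize (Hlt (m - h) ltac:(lra)).
    assert (Htri := norm_minus_triangle (phi (m - h)) (phi m) (phi 0)).
    assert (0 <= (c + eps) * h) by (apply Rmult_le_pos; lra).
    lra. }
  destruct (Req_dec m t) as [Emt|Hne]; [now rewrite <- Emt|].
  exfalso; destruct (Hright m eps ltac:(lra) He) as [d [Hd H]].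
  set (h := Rmin d (t - m) / 2).
  assert (Hh : 0 < h /\ h < d /\ h < t - m).
  { assert (0 < Rmin d (t - m)) by (apply Rmin_pos; lra).
    generalize (Rmin_l d (t - m)) (Rmin_r d (t - m)); unfold h; lra. }
  assert (HE : E (m + h)).
  { split; [lra|]; intros u Hu.
    destruct (Rlt_le_dec u m) as [Hum|Hum]; [apply Hlt; lra|].
    destruct (Req_dec u m) as [->|Hne']; [exact Hm|].
    specialize (H (u - m) ltac:(lra) ltac:(lra)).
    replace (m + (u - m)) with u in H by ring.
    assert (Htri := norm_minus_triangle (phi m) (phi u) (phi 0)).
    lra. }
  apply Hub in HE; lra. }
apply le_epsilon; intros e He.
destruct (Req_dec t 0) as [->|Hne]; [rewrite norm_minus_self; lra|].
specialize (Hmain (e / t) ltac:(apply Rdiv_lt_0_compat; lra)).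
replace ((c + e / t) * t) with (c * t + e) in Hmain by (field; lra); exact Hmain.
Qed.

Section Perturbation.

Context {X : CompleteNormedModule C_AbsRing} {T S : R -> X -> X} (beta : R).
Hypothesis HT : C0_semigroup T.
Hypothesis HS : C0_semigroup S.
Hypothesis Hbeta : 0 <= beta.
(** [S] will be generated by [A + B D C], with [z = B D C x]. *)
Hypothesis Hgen : forall x, (exists y, generator_limit T x y) ->
  exists y z, generator_limit T x y /\ generator_limit S x (plus y z) /\
    norm z <= beta * norm x.

Lemma generator_limit_orbit s x y :
  0 <= s -> generator_limit T x y -> generator_limit T (T s x) (T s y).
Proof.
intros Hs Hxy; apply generator_limit_iff; intros eps He.
assert (HL := semigroup_linear HT s Hs).
destruct (is_linear_bounded (T s) HL) as [K [HK0 HK]].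
destruct (proj1 (generator_limit_iff T x y) Hxy (eps / K)) as [d [Hd H]].
  now apply Rdiv_lt_0_compat.
exists d; split; [exact Hd|]; intros h Hh; specialize (H h Hh).
rewrite (semigroup_comm HT h s) by lra.
rewrite <- (op_minus (T s)), <- (op_scal (T s)), <- (op_minus (T s)) by exact HL.
eapply Rle_lt_trans; [apply HK|].
apply Rmult_lt_compat_l with (r := K) in H; [|exact HK0].
replace (K * (eps / K)) with eps in H by (field; lra); exact H.
Qed.

Lemma generator_difference x eps :
  (exists y, generator_limit T x y) -> 0 < eps ->
  exists d, 0 < d /\ forall h, 0 < h < d ->
    norm (minus (T h x) (S h x)) <= (beta * norm x + eps) * h.
Proof.
intros Hx He; destruct (Hgen x Hx) as [y [z [HTy [HSy Hz]]]].
destruct (proj1 (generator_limit_iff T x y) HTy (eps / 2)) as [d1 [Hd1 H1]]; [lra|].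
destruct (proj1 (generator_limit_iff S x _) HSy (eps / 2)) as [d2 [Hd2 H2]]; [lra|].
exists (Rmin d1 d2); split; [now apply Rmin_pos|]; intros h [Hh0 Hh].
specialize (H1 h (conj Hh0 (Rlt_le_trans _ _ _ Hh (Rmin_l _ _)))).
specialize (H2 h (conj Hh0 (Rlt_le_trans _ _ _ Hh (Rmin_r _ _)))).
set (a := minus (scal (RtoC (/ h) : C_AbsRing) (minus (T h x) x)) y : X) in H1.
set (b := minus (scal (RtoC (/ h) : C_AbsRing) (minus (S h x) x)) (plus y z) : X) in H2.
assert (Hh1 : RtoC h <> RtoC 0) by (intros E0; apply RtoC_inj in E0; lra).
assert (E : minus (T h x) (S h x) =
    scal (RtoC h : C_AbsRing) (minus (minus a b : X) z : X)).
{ unfold a, b; rewrite RtoC_inv by lra; vec_reflect; cnorm; field; exact Hh1. }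
rewrite E, norm_scal_C, Cmod_R, Rabs_right by lra.
rewrite (Rmult_comm _ h); apply Rmult_le_compat_l; [lra|].
generalize (norm_minus_le (minus a b : X) z) (norm_minus_le a b); lra.
Qed.

(** The mean value inequality along [S (t - s) (T s x)], which runs from [S t x] to [T t x]; it
    takes the place of the Duhamel formula. *)
Lemma perturbation_estimate_domain t KT KS x :
  0 <= t -> 0 < KT -> 0 < KS ->
  (forall s, 0 <= s <= t -> bounded_by KT (T s)) ->
  (forall s, 0 <= s <= t -> bounded_by KS (S s)) ->
  (exists y, generator_limit T x y) ->
  norm (minus (S t x) (T t x)) <= t * (KS * KT * beta) * norm x.
Proof.
intros Ht HKT0 HKS0 HKT HKS [y Hy].
assert (Hx := norm_ge_0 x).
pose (phi := fun s => S (t - s) (T s x)).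
replace (S t x) with (phi 0)
  by (unfold phi; rewrite Rminus_0_r, (semigroup_0 HT); easy).
replace (T t x) with (phi t)
  by (unfold phi; rewrite Rminus_diag; apply (semigroup_0 HS)).
rewrite norm_minus_sym.
replace (t * (KS * KT * beta) * norm x) with (KS * (beta * (KT * norm x)) * t) by ring.
assert (Hb : 0 <= beta * (KT * norm x)) by (repeat apply Rmult_le_pos; lra).
apply mean_value_right; [exact Ht|apply Rmult_le_pos; lra| |].
- intros s eps Hs He.
  destruct (generator_difference (T s x) (eps / KS)) as [d [Hd H]].
    exists (T s y); apply generator_limit_orbit; [lra|exact Hy].
    now apply Rdiv_lt_0_compat.
  exists d; split; [exact Hd|]; intros h Hh Hsh; specialize (H h Hh).
  replace (minus (phi (s + h)) (phi s))
    with (S (t - s - h) (minus (T h (T s x)) (S h (T s x)))).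
  + eapply Rle_trans; [apply HKS; lra|].
    assert (Hb2 : beta * norm (T s x) <= beta * (KT * norm x)).
    { apply Rmult_le_compat_l; [exact Hbeta|apply HKT; lra]. }
    apply Rle_trans with (KS * ((beta * (KT * norm x) + eps / KS) * h)).
      apply Rmult_le_compat_l; [lra|].
      apply Rle_trans with (1 := H), Rmult_le_compat_r; lra.
    apply Req_le; field; lra.
  + rewrite (op_minus (S (t - s - h))) by (apply (semigroup_linear HS); lra).
    rewrite <- (semigroup_plus HT), <- (semigroup_plus HS) by lra.
    unfold phi; replace (t - (s + h)) with (t - s - h) by ring.
    replace (s + h) with (h + s) by ring.
    now replace (t - s - h + h) with (t - s) by ring.
(* Left continuity of [phi]: the increment is [S (t - s)] applied to [S h (v - w) - (S h v - v)]
   with [v = T s x] and [w = T (s - h) x]; the constants leave [eps / 2] for each part. *)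
- intros s eps Hs He.
  destruct (semigroup_right_continuous HS (T s x) (eps / (2 * KS))) as [d1 [Hd1 H1]].
    apply Rdiv_lt_0_compat; lra.
  destruct (semigroup_right_continuous HT x (eps / (2 * (KS * KS * KT))))
    as [d2 [Hd2 H2]].
    apply Rdiv_lt_0_compat; [lra|]; repeat apply Rmult_lt_0_compat; lra.
  exists (Rmin d1 d2); split; [now apply Rmin_pos|]; intros h [Hh0 Hh] Hsh.
  specialize (H1 h (conj Hh0 (Rlt_le_trans _ _ _ Hh (Rmin_l _ _)))).
  specialize (H2 h (conj Hh0 (Rlt_le_trans _ _ _ Hh (Rmin_r _ _)))).
  assert (H3 : norm (minus (T s x) (T (s - h) x)) <= KT * norm (minus (T h x) x)).
  { replace s with (s - h + h) at 1 by ring.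
    apply (semigroup_orbit_lipschitz HT t); [exact HKT|lra|lra]. }
  assert (HSh := semigroup_linear HS h ltac:(lra)).
  replace (minus (phi s) (phi (s - h))) with
    (S (t - s) (minus (S h (minus (T s x) (T (s - h) x)))
      (minus (S h (T s x)) (T s x)))).
  + eapply Rle_trans; [apply HKS; lra|].
    apply Rle_trans with (KS * (KS * (KT * (eps / (2 * (KS * KS * KT)))) + eps / (2 * KS))).
    2: apply Req_le; field; lra.
    apply Rmult_le_compat_l; [lra|].
    eapply Rle_trans; [apply norm_minus_le|].
    apply Rplus_le_compat; [|lra].
    eapply Rle_trans; [apply HKS; lra|].
    apply Rmult_le_compat_l; [lra|].
    apply Rle_trans with (1 := H3), Rmult_le_compat_l; lra.
  + rewrite (op_minus (S h)) by exact HSh.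
    unfold phi; replace (t - (s - h)) with (t - s + h) by ring.
    rewrite (semigroup_plus HS) by lra.
    rewrite <- (op_minus (S (t - s))) by (apply (semigroup_linear HS); lra).
    f_equal; vec.
Qed.

Lemma perturbation_estimate t KT KS :
  0 <= t -> 0 < KT -> 0 < KS ->
  (forall s, 0 <= s <= t -> bounded_by KT (T s)) ->
  (forall s, 0 <= s <= t -> bounded_by KS (S s)) ->
  bounded_by (t * (KS * KT * beta)) (fun x => minus (S t x) (T t x)).
Proof.
intros Ht HKT0 HKS0 HKT HKS x.
apply le_epsilon; intros e He.
set (c := t * (KS * KT * beta)).
assert (Hc : 0 <= c) by (unfold c; repeat apply Rmult_le_pos; lra).
(* Replacing [x] by [y] will cost at most [KS + KT + c] times [eta]. *)
set (eta := e / (KS + KT + c)).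
assert (Heta : 0 < eta) by (apply Rdiv_lt_0_compat; lra).
destruct (generator_domain_dense HT x eta Heta) as [y [Hy Hyx]].
assert (Hdom := perturbation_estimate_domain t KT KS y Ht HKT0 HKS0 HKT HKS Hy).
fold c in Hdom.
assert (H1 : norm (minus (S t x) (S t y)) <= KS * eta).
{ rewrite <- (op_minus (S t)) by (now apply (semigroup_linear HS)).
  eapply Rle_trans; [apply HKS; lra|].
  rewrite norm_minus_sym; apply Rmult_le_compat_l; lra. }
assert (H2 : norm (minus (T t y) (T t x)) <= KT * eta).
{ rewrite <- (op_minus (T t)) by (now apply (semigroup_linear HT)).
  eapply Rle_trans; [apply HKT; lra|]; apply Rmult_le_compat_l; lra. }
assert (H3 : c * norm y <= c * (norm x + eta)).
{ apply Rmult_le_compat_l; [exact Hc|]; generalize (norm_le_minus y x); lra. }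
assert (H4 : (KS + KT + c) * eta = e) by (unfold eta; field; lra).
generalize (norm_minus_triangle (S t y) (S t x) (T t x))
  (norm_minus_triangle (T t y) (S t y) (T t x)); lra.
Qed.

(** The a priori bound [K] on [S] depends on the perturbation. Feeding a bound [K'] into the
    estimate returns [KT + K' / 2]; iterating contracts to the fixed point [2 * KT], which depends
    on [T] alone. *)
Lemma perturbed_semigroup_bound t KT :
  0 <= t -> 0 < KT -> t * KT * beta <= / 2 ->
  (forall s, 0 <= s <= t -> bounded_by KT (T s)) ->
  forall s, 0 <= s <= t -> bounded_by (2 * KT) (S s).
Proof.
intros Ht HKT0 Hsmall HKT.
destruct (semigroup_locally_bounded HS t) as [K [HK0 HK]].
assert (Hn : forall n : nat, forall s, 0 <= s <= t ->
    bounded_by (2 * KT + K * (/ 2) ^ n) (S s)).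
{ induction n as [|n IH]; intros s Hs.
    apply bounded_by_le with K; [simpl; lra|now apply HK].
  assert (Hp : 0 < K * (/ 2) ^ n)
    by (apply Rmult_lt_0_compat; [lra|apply pow_lt; lra]).
  set (K' := 2 * KT + K * (/ 2) ^ n) in *.
  assert (HK' : 0 < K') by (unfold K'; lra).
  intros x.
  assert (H1 := perturbation_estimate s KT K' ltac:(lra) HKT0 HK'
    ltac:(intros; apply HKT; lra) ltac:(intros; apply IH; lra) x); cbv beta in H1.
  assert (H2 := HKT s Hs x).
  assert (H3 := norm_le_minus (S s x) (T s x)).
  assert (H4 : s * (K' * KT * beta) * norm x <= K' * / 2 * norm x).
  { apply Rmult_le_compat_r; [apply norm_ge_0|].
    replace (s * (K' * KT * beta)) with (K' * (s * (KT * beta))) by ring.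
    apply Rmult_le_compat_l; [lra|].
    apply Rle_trans with (2 := Hsmall); rewrite Rmult_assoc.
    apply Rmult_le_compat_r; [apply Rmult_le_pos|]; lra. }
  replace (2 * KT + K * (/ 2) ^ Datatypes.S n) with (KT + K' * / 2)
    by (unfold K'; simpl; field).
  lra. }
intros s Hs x; apply le_epsilon; intros e He.
destruct (half_pow_small (K * norm x) e He) as [n Hnx].
generalize (Hn n s Hs x); lra.
Qed.

End Perturbation.

Lemma op_norm_bounded {V W : CompleteNormedModule C_AbsRing} (D : V -> W) (r : R) :
  is_linear D -> Rbar_le (op_norm D) r -> bounded_by r D.
Proof.
intros HD Hr x.
destruct (Req_dec (norm x) 0) as [E|E].
  apply (norm_0_eq_zero x) in E; subst x.
  rewrite (op_zero D HD), !norm_zero_eq; lra.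
assert (Hx : 0 < norm x) by (generalize (norm_ge_0 x); lra).
assert (Hle : norm (scal (RtoC (/ norm x) : C_AbsRing) (D x)) <= r).
{ change (Rbar_le (norm (scal (RtoC (/ norm x) : C_AbsRing) (D x))) r).
  apply Rbar_le_trans with (2 := Hr).
  apply (proj1 (Lub_Rbar_correct _)).
  exists (scal (RtoC (/ norm x) : C_AbsRing) x); split.
    rewrite norm_scal_C, Cmod_R, Rabs_right; [right; field; lra|].
    apply Rle_ge, Rlt_le, Rinv_0_lt_compat, Hx.
  now rewrite (op_scal D). }
rewrite norm_scal_C, Cmod_R, Rabs_right in Hle.
2: apply Rle_ge, Rlt_le, Rinv_0_lt_compat, Hx.
apply Rmult_le_compat_r with (r := norm x) in Hle; [|lra].
replace (/ norm x * norm (D x) * norm x) with (norm (D x)) in Hle by (field; lra).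
exact Hle.
Qed.

(** The inverse [Q] of [l - T t] is an approximate inverse of [l - S t] once the norm of [S t - T t]
    times that of [Q] is at most 1/2. The bound on [S] being independent of [D], the radius [r] can
    be fixed first. *)
Lemma resolvent_set_perturbation_stable {X U Y : CompleteNormedModule C_AbsRing}
    (T : R -> X -> X) (A : unbounded_op X) (B : U -> X) (C : X -> Y) (t : R)
    (l : Complex.C) :
  generates A T -> is_linear B -> is_linear C -> 0 <= t -> resolvent_set (T t) l ->
  exists r, 0 < r /\
    forall D : Y -> U, is_linear D -> Rbar_le (op_norm D) r ->
    forall S, generates (perturb A B D C) S -> resolvent_set (S t) l.
Proof.
intros [HT [HA1 HA2]] HB HC Ht HR.
apply resolvent_set_invertible in HR; destruct HR as [Q [HQ [E1 E2]]].
destruct (is_linear_bounded Q HQ) as [q [Hq0 Hq]].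
destruct (is_linear_bounded B HB) as [b [Hb0 Hb]].
destruct (is_linear_bounded C HC) as [c [Hc0 Hc]].
destruct (semigroup_locally_bounded HT t) as [K [HK0 HK]].
set (m := t * K * (b * c)).
assert (Hm : 0 <= m) by (unfold m; repeat apply Rmult_le_pos; lra).
assert (Hqm : 0 <= 2 * (q * K * m)) by (repeat apply Rmult_le_pos; lra).
(* With [r = / (2 * w)], both [m * r = t * K * beta] and [2 * (q * K * m) * r = q * e] are at most
   1/2; the summand 1 keeps [w] positive. *)
set (w := 1 + m + 2 * (q * K * m)).
assert (Hw : 1 <= w) by (unfold w; lra).
set (r := / (2 * w)).
assert (Hr0 : 0 < r) by (apply Rinv_0_lt_compat; lra).
assert (Hwr : w * r = / 2) by (unfold r; field; lra).
exists r; split; [exact Hr0|]; intros D HD HDr S [HS [HSA1 HSA2]].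
assert (HDb := op_norm_bounded D r HD HDr).
set (beta := b * (r * c)).
assert (Hbeta : 0 <= beta) by (unfold beta; repeat apply Rmult_le_pos; lra).
assert (Hgen : forall x, (exists y, generator_limit T x y) ->
    exists y z, generator_limit T x y /\ generator_limit S x (plus y z) /\
      norm z <= beta * norm x).
{ intros x Hx; apply HA1 in Hx.
  exists (op A x), (B (D (C x))); split; [now apply HA2|split].
    exact (HSA2 x Hx).
  unfold beta.
  apply (bounded_by_comp (fun x => D (C x)) B); [lra| |exact Hb].
  apply bounded_by_comp; [lra|exact Hc|exact HDb]. }
assert (Hm1 : m * r <= / 2).
{ rewrite <- Hwr; apply Rmult_le_compat_r; [lra|]; unfold w; lra. }
assert (Hm2 : 2 * (q * K * m) * r <= / 2).
{ rewrite <- Hwr; apply Rmult_le_compat_r; [lra|]; unfold w; lra. }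
assert (Hsmall : t * K * beta <= / 2)
  by (replace (t * K * beta) with (m * r) by (unfold m, beta; ring); exact Hm1).
assert (HKS := perturbed_semigroup_bound beta HT HS Hbeta Hgen t K Ht HK0 Hsmall HK).
assert (HdTS := perturbation_estimate beta HT HS Hbeta Hgen t K (2 * K) Ht HK0
  ltac:(lra) HK HKS).
set (e := t * (2 * K * K * beta)) in HdTS.
assert (Heq : q * e <= / 2).
{ replace (q * e) with (2 * (q * K * m) * r) by (unfold e, m, beta; ring); exact Hm2. }
assert (He : 0 <= e) by (unfold e; repeat apply Rmult_le_pos; lra).
assert (HTl := semigroup_linear HT t Ht); assert (HSl := semigroup_linear HS t Ht).
apply resolvent_set_invertible.
apply approximate_inverse_invertible with Q.
- apply (is_linear_minus_fun (scal (l : C_AbsRing))); [|exact HSl].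
  exact (is_linear_scal_fun l (fun x => x) is_linear_id).
- exact HQ.
- intros x; rewrite <- (E1 x) at 3; rewrite <- (op_minus Q) by exact HQ.
  eapply Rle_trans; [apply Hq|].
  apply Rle_trans with (q * (e * norm x)).
    apply Rmult_le_compat_l; [lra|].
    eapply Rle_trans; [|apply HdTS].
    rewrite <- norm_opp_eq; apply Req_le; f_equal; vec.
  rewrite <- Rmult_assoc; apply Rmult_le_compat_r; [apply norm_ge_0|exact Heq].
- intros x; rewrite <- (E2 x) at 3.
  apply Rle_trans with (e * (q * norm x)).
    apply Rle_trans with (e * norm (Q x)).
      eapply Rle_trans; [|apply HdTS].
      rewrite <- norm_opp_eq; apply Req_le; f_equal; vec.
    apply Rmult_le_compat_l; [exact He|apply Hq].
  replace (e * (q * norm x)) with (q * e * norm x) by ring.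
  apply Rmult_le_compat_r; [apply norm_ge_0|exact Heq].
Qed.

(** * The two radii *)

Lemma spectrum_avoids_circle_of_resolvent {X : CompleteNormedModule C_AbsRing}
    (W : X -> X) :
  (forall xi, 0 <= xi <= 1 -> resolvent_set W (expi (2 * PI * xi))) ->
  spectrum_avoids_circle W.
Proof.
intros H z [Hz1 Hz2]; apply Hz1.
destruct (unit_circle_expi z Hz2) as [xi [Hxi ->]]; now apply H.
Qed.

(** Rotation by [- xi] or [xi] passes between the two generators; at time [2 * PI] it moves
    [e^{2 pi i xi}] to 1 and back. *)
Lemma shifted_semigroup_resolvent {X U Y : CompleteNormedModule C_AbsRing}
    (A : unbounded_op X) (B : U -> X) (D : Y -> U) (C : X -> Y) (xi : R) :
  (forall S, generates (perturb (shift A xi) B D C) S ->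
    resolvent_set (S (2 * PI)) (RtoC 1)) <->
  (forall S, generates (perturb A B D C) S ->
    resolvent_set (S (2 * PI)) (expi (2 * PI * xi))).
Proof.
assert (HP := PI_RGT_0).
split; intros H S HS.
- assert (HS' : generates (perturb (shift A xi) B D C) (rotated (- xi) S)).
  { revert HS; apply rotated_generates; [easy|]; intros x; simpl.
    rewrite RtoC_opp; vec. }
  specialize (H _ HS'); rewrite <- expi_0 in H.
  rewrite <- (Rplus_0_r (2 * PI * xi)).
  revert H; apply resolvent_set_rotate.
    apply (semigroup_linear (proj1 HS')); lra.
  intros x; rewrite <- (rotated_opp (- xi) S) at 1; unfold rotated at 1.
  now replace (- - xi * (2 * PI)) with (2 * PI * xi) by ring.
- assert (HS' : generates (perturb A B D C) (rotated xi S)).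
  { revert HS; apply rotated_generates; [easy|]; intros x; simpl; vec. }
  specialize (H _ HS').
  rewrite <- expi_0, <- (Rplus_opp_l (2 * PI * xi)).
  revert H; apply resolvent_set_rotate.
    apply (semigroup_linear (proj1 HS')); lra.
  intros x; rewrite <- (rotated_opp xi S) at 1; unfold rotated at 1.
  now replace (- xi * (2 * PI)) with (- (2 * PI * xi)) by ring.
Qed.

Theorem lemma4p5 (X U Y : CompleteNormedModule C_AbsRing)
    (T : R -> X -> X) (A : unbounded_op X) (B : U -> X) (C : X -> Y)
    (hT : C0_semigroup T) (hA : is_generator A T) (hhyp : hyperbolic T)
    (hB : is_linear B) (hC : is_linear C) :
  rc_dich A B C =
  Rbar_glb (fun v : Rbar =>
    exists xi : R, 0 <= xi <= 1 /\ v = rc1_stab (shift A xi) B C).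
Proof.
assert (HP := PI_RGT_0).
(* [dich] and [stab] leave out the sign conditions, which differ: [0 <= r] in one radius, [0 < r] in
   the other. *)
set (dich := fun r : R => forall D : Y -> U, is_linear D -> Rbar_le (op_norm D) r ->
  forall S, generates (perturb A B D C) S ->
  forall t, 0 < t -> spectrum_avoids_circle (S t)).
set (stab := fun xi r : R => forall D : Y -> U, is_linear D -> Rbar_le (op_norm D) r ->
  forall S, generates (perturb (shift A xi) B D C) S ->
  resolvent_set (S (2 * PI)) (RtoC 1)).
assert (Hdich : forall r, (forall xi, 0 <= xi <= 1 -> stab xi r) -> dich r).
{ intros r H D HD HDr S HS t Ht.
  (* The pointwise conditions speak of time [2 * PI] only; hyperbolicity carries the conclusion to
     every [t > 0]. *)
  assert (Hhyp : hyperbolic S).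
  { exists (2 * PI); split; [lra|].
    apply spectrum_avoids_circle_of_resolvent; intros xi Hxi.
    revert S HS; apply shifted_semigroup_resolvent; exact (H xi Hxi D HD HDr). }
  apply spectrum_avoids_circle_of_resolvent; intros xi _.
  now apply hyperbolic_resolvent_set; [apply HS|..]. }
assert (Hstab : forall xi r, dich r -> stab xi r).
{ intros xi r H D HD HDr; apply shifted_semigroup_resolvent; intros S HS.
  apply NNPP; intros Hn.
  apply (H D HD HDr S HS (2 * PI) ltac:(lra) (expi (2 * PI * xi))).
  split; [exact Hn|apply Cmod_expi]. }
assert (Hmono : forall xi r s, r <= s -> stab xi s -> stab xi r).
{ intros xi r s Hrs H D HD HDr; apply (H D HD).
  apply Rbar_le_trans with (1 := HDr); exact Hrs. }
assert (Hpos : forall xi, exists r, 0 < r /\ stab xi r).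
{ intros xi.
  destruct (resolvent_set_perturbation_stable T A B C (2 * PI) (expi (2 * PI * xi)))
    as [r [Hr H]]; [now split|exact hB|exact hC|lra| |].
    apply hyperbolic_resolvent_set; [exact hT|exact hhyp|lra].
  exists r; split; [exact Hr|].
  intros D HD HDr; apply shifted_semigroup_resolvent; exact (H D HD HDr). }
symmetry; apply Rbar_is_glb_unique.
unfold rc_dich; fold dich.
split.
- intros v [xi [Hxi ->]].
  unfold rc1_stab; fold (stab xi).
  destruct (Hpos xi) as [r0 [Hr0 H0]].
  apply (proj2 (Lub_Rbar_correct _)); intros r [Hr Hd].
  (* [r = 0] may enter the first supremum but not the second, where the positive [r0] dominates
     it. *)
  destruct (Req_dec r 0) as [->|Hne].
    apply Rbar_le_trans with r0; [simpl; lra|].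
    apply (proj1 (Lub_Rbar_correct _)); now split.
  apply (proj1 (Lub_Rbar_correct _)); split; [lra|]; exact (Hstab xi r Hd).
- intros b Hb.
  match goal with |- Rbar_le _ ?v => set (L := v) end.
  assert (Hub : forall r : R, 0 <= r -> dich r -> Rbar_le r L).
  { intros r Hr Hd; apply (proj1 (Lub_Rbar_correct _)); now split. }
  assert (H0 : dich 0).
  { apply Hdich; intros xi _; destruct (Hpos xi) as [r [Hr H]].
    apply Hmono with r; [lra|exact H]. }
  (* If [stab xi r] failed, no admissible [s] could exceed [r] by monotonicity, so the radius at
     [xi] would be at most [r], below the lower bound [b]. *)
  assert (Hlt : forall r : R, 0 <= r -> Rbar_lt r b -> dich r).
  { intros r Hr Hrb; apply Hdich; intros xi Hxi.
    apply NNPP; intros Hn.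
    apply (Rbar_lt_not_le _ _ Hrb).
    apply Rbar_le_trans with (1 := Hb _ (ex_intro _ xi (conj Hxi eq_refl))).
    apply (proj2 (Lub_Rbar_correct _)); intros s [Hs Hss].
    simpl; apply Rnot_lt_le; intros Hrs; apply Hn.
    apply Hmono with s; [lra|exact Hss]. }
  apply Rbar_not_lt_le; intros Hlub.
  (* Admissibility of 0 excludes [L = -infinity]. If [L < b], some real above [L] and below [b] is
     admissible: the midpoint, or [l + 1] when [b] is infinite. *)
  specialize (Hub 0 (Rle_refl 0) H0) as Hub0.
  clearbody L; destruct L as [l| |]; simpl in Hub0; [| |easy].
  + destruct b as [b| |]; simpl in Hlub; [| |easy].
      assert (H := Hub ((l + b) / 2) ltac:(lra)
        (Hlt ((l + b) / 2) ltac:(lra) ltac:(simpl; lra))).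
      simpl in H; lra.
    assert (H := Hub (l + 1) ltac:(lra) (Hlt (l + 1) ltac:(lra) I)).
    simpl in H; lra.
  + destruct b; easy.
Qed.
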